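(* The following hold for the class $\mathcal{S}^*_c$: (i) $R_{\mathcal{S}_c^*}(\mathcal{T}_1)=1/4$; (ii) $R_{\mathcal{S}_c^*}(\mathcal{T}_2)=(4-\sqrt{10})/3$ $(\approx 0.279241)$; (iii) $R_{\mathcal{S}_c^*}(\mathcal{T}_3)=2/\sqrt{77}$ $(\approx 0.227921)$.
   Context: Let $\mathbb{D}=\{z\in\mathbb{C}:|z|<1\}$ and let $\mathcal{A}$ be the class of analytic functions $f:\mathbb{D}\to\mathbb{C}$ with $f(0)=0$, $f'(0)=1$. For analytic $f,g$ on $\mathbb{D}$, $f\prec g$ ($f$ is subordinate to $g$) means $f=g\circ w$ for some analytic $w:\mathbb{D}\to\mathbb{D}$ with $w(0)=0$. Square roots are principal branches, and quotients such as $f/g$, $g/(zp)$, $zf'/f$ are understood with removable singularities at $0$ filled in. Define $\mathcal{T}_1$: all $f\in\mathcal{A}$ such that $f/g\prec e^z$ and $g/(zp)\prec e^z$ for some $g\in\mathcal{A}$ and some $p\prec\sqrt{1+z}$; $\mathcal{T}_2$: all $f\in\mathcal{A}$ such that $f/g\prec \sqrt{1+z}$ and $g/(zp)\prec \sqrt{1+z}$ for some $g\in\mathcal{A}$ and some $p\prec e^z$; $\mathcal{T}_3$: all $f\in\mathcal{A}$ such that $f/g\prec z+\sqrt{1+z^2}$ and $g/(zp)\prec z+\sqrt{1+z^2}$ for some $g\in\mathcal{A}$ and some $p\prec z+\sqrt{1+z^2}$. $\mathcal{S}^*_c$ is the class of $f\in\mathcal{A}$ with $zf'(z)/f(z)\prec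 1+\frac43 z+\frac23 z^2$ (starlike functions associated with a cardioid). For classes $\mathcal{G},\mathcal{M}\subset\mathcal{A}$, the $\mathcal{G}$-radius $R_{\mathcal{G}}(\mathcal{M})$ is $\inf\{\rho_f: f\in\mathcal{M}\}$, where $\rho_f$ is the largest number in $(0,1]$ such that for every $0<r\le\rho_f$ the function $f$ has the property defining $\mathcal{G}$ in the disk $|z|<r$, i.e. $z\mapsto f(rz)/r$ belongs to $\mathcal{G}$. *)

(* Defs.v *)
From Stdlib Require Import Reals Lra.
From Coquelicot Require Import Coquelicot.
Open Scope R_scope.

(* Functions on the open unit disk are total functions C -> C of which only
   the values on the disk matter. *)
Definition inD (z : C) : Prop := Cmod z < 1.

Definition analyticD (f : C -> C) : Prop :=
  forall z : C, inD z -> @ex_derive C_AbsRing C_NormedModule f z.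

Definition classA (f : C -> C) : Prop :=
  analyticD f /\ f (RtoC 0) = RtoC 0 /\ C_derive f (RtoC 0) = RtoC 1.

Definition Cexp (z : C) : C :=
  (exp (Re z) * cos (Im z), exp (Re z) * sin (Im z)).

(* Principal branch: the root of nonnegative real part, cut along the negative
   real axis (where the root of nonnegative imaginary part is taken). *)
Definition Csqrt (z : C) : C :=
  (sqrt ((Cmod z + Re z) / 2),
   if Rle_dec 0 (Im z) then sqrt ((Cmod z - Re z) / 2)
   else - sqrt ((Cmod z - Re z) / 2)).

Lemma Csqrt_mult (z : C) : (Csqrt z * Csqrt z)%C = z.
Proof.
assert (Hn : Cmod z * Cmod z = Re z * Re z + Im z * Im z).
{ generalize (Cmod2_alt z); simpl; lra. }
assert (H0 := Cmod_ge_0 z).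
assert (Hr := re_le_Cmod z).
assert (Hr1 := Rle_trans _ _ _ (Rle_abs _) Hr).
assert (Hr2 : - Re z <= Cmod z).
{ apply Rle_trans with (2 := Hr); rewrite <- Rabs_Ropp; apply Rle_abs. }
assert (Ha : 0 <= (Cmod z + Re z) / 2) by lra.
assert (Hb : 0 <= (Cmod z - Re z) / 2) by lra.
assert (Sa := sqrt_sqrt _ Ha).
assert (Sb := sqrt_sqrt _ Hb).
assert (Hm : sqrt ((Cmod z + Re z) / 2) * sqrt ((Cmod z - Re z) / 2)
             = Rabs (Im z) / 2).
{ rewrite <- sqrt_mult by assumption.
  replace ((Cmod z + Re z) / 2 * ((Cmod z - Re z) / 2))
    with (Rsqr (Im z / 2)) by (unfold Rsqr; nra).
  rewrite sqrt_Rsqr_abs; unfold Rdiv; rewrite Rabs_mult.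
  rewrite (Rabs_pos_eq (/ 2)) by lra; reflexivity. }
unfold Csqrt; destruct (Rle_dec 0 (Im z)) as [Hi | Hi].
- rewrite Rabs_pos_eq in Hm by assumption.
  destruct z as [x y]; unfold Cmult, Re, Im in *; simpl in *.
  f_equal; lra.
- rewrite Rabs_left in Hm by lra.
  destruct z as [x y]; unfold Cmult, Re, Im in *; simpl in *.
  f_equal; lra.
Qed.

(* h with the value at 0 replaced by the limit of h at 0: this fills in a
   removable singularity at 0. *)
Definition fill0 (h : C -> C) (z : C) : C :=
  if Ceq_dec z (RtoC 0) then C_lim h (RtoC 0) else h z.

(* When g is analytic, f = g o w on the disk already forces f to be analytic
   there. Likewise, a quotient subordinate to a zero-free g cannot have its
   denominator vanish in the disk away from 0, since x / 0 = 0. *)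
Definition subordinate (f g : C -> C) : Prop :=
  exists w : C -> C,
    analyticD w /\
    (forall z : C, inD z -> inD (w z)) /\
    w (RtoC 0) = RtoC 0 /\
    (forall z : C, inD z -> f z = g (w z)).

(* The functions f such that f/g < phi and g/(z p) < phi for some g in A and
   some p < psi, where < is subordination. *)
Definition ratio_class (phi psi : C -> C) (f : C -> C) : Prop :=
  classA f /\
  exists g p : C -> C,
    classA g /\
    subordinate p psi /\
    subordinate (fill0 (fun z => (f z / g z)%C)) phi /\
    subordinate (fill0 (fun z => (g z / (z * p z))%C)) phi.

Definition lemniscate (z : C) : C := Csqrt (RtoC 1 + z)%C.
Definition lune (z : C) : C := (z + Csqrt (RtoC 1 + z * z))%C.
Definition cardioid (z : C) : C :=
  (RtoC 1 + RtoC (4 / 3) * z + RtoC (2 / 3) * (z * z))%C.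

Definition T1 : (C -> C) -> Prop := ratio_class Cexp lemniscate.
Definition T2 : (C -> C) -> Prop := ratio_class lemniscate Cexp.
Definition T3 : (C -> C) -> Prop := ratio_class lune lune.

Definition starlike_c (f : C -> C) : Prop :=
  classA f /\
  subordinate (fill0 (fun z => (z * C_derive f z / f z)%C)) cardioid.

Definition dilate (r : R) (f : C -> C) (z : C) : C :=
  (f (RtoC r * z) / RtoC r)%C.

Definition holds_up_to (G : (C -> C) -> Prop) (f : C -> C) (rho : R) : Prop :=
  0 < rho <= 1 /\ forall r : R, 0 < r <= rho -> G (dilate r f).

Definition is_rho (G : (C -> C) -> Prop) (f : C -> C) (rho : R) : Prop :=
  holds_up_to G f rho /\
  forall rho' : R, holds_up_to G f rho' -> rho' <= rho.

(* R_G(M) = rad. The first conjunct says that rho_f is defined for every f in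
   M, so that no member of M is left out of the infimum. *)
Definition is_radius (G M : (C -> C) -> Prop) (rad : R) : Prop :=
  (forall f : C -> C, M f -> exists rho : R, is_rho G f rho) /\
  is_glb_Rbar (fun rho : R => exists f : C -> C, M f /\ is_rho G f rho)
    (Finite rad).

(* Main.v *)
Require Import Defs.
From Stdlib Require Import Reals Lra Psatz ClassicalEpsilon.
From Coquelicot Require Import Coquelicot.
Open Scope R_scope.

(** Each f in these classes is f = z phi(w1) phi(w2) psi(w3) with Schwarz
    functions wj, so that z f'/f = 1 + sum of the terms z wj' L(wj), L being a
    logarithmic derivative. Dieudonne's inequality
    |z w' - w| <= (|z|^2 - |w|^2) / (1 - |z|^2) bounds these terms. For T1 and T2
    they keep z f'/f in the disk |s - 1| < 2/3, which lies in the cardioid domain.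
    For T3 the corresponding disk is too large; but the cardioid domain contains
    every s near 1 with Re s > 1/3, its cusp, and Dieudonne's inequality still
    gives Re (z w' / sqrt (1 + w^2)) > -2/9 for |z| < 2/sqrt 77. Equality holds
    for w(z) = z at z = -rad, where z f'/f hits the cusp 1/3.

    As the members of A are only assumed complex differentiable, the analyticity
    of z f'/f requires Goursat's theorem and Cauchy's formula. Goursat's theorem is
    proved by bisecting the parameter rectangle of a homotopy, so that the
    contraction of a circle to a point gives Cauchy's formula and removes
    singularities as well. *)

(** * Complex differentiation *)

(** Since [cardioid u] = 1/3 + 2/3 (1 + u)^2 is univalent on the disk, with a principal square root
    in its inverse, subordination to it of an analytic function with value 1 at 0 is the pointwise
    condition [in_cardioid]. Each radius is then the least |z| at which a value of z f'/f can leave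
    the domain. For wj(z) = z at z = -r the three terms add up to -2/3 when 2 r + r / (2 (1 - r)) =
    2/3 for [T1], r / (1 - r) + r = 2/3 for [T2] and 3 r / sqrt (1 + r^2) = 2/3 for [T3]; these
    equations produce the three radii. In [T3] a term can have modulus r / sqrt (1 - r^2), at
    imaginary w, and three times this exceeds 2/3 at r = 2/sqrt 77; this is why real parts are
    treated separately there. The maximum principle is used only in the form of the mean value
    property at 0, so other points are first moved to 0 by automorphisms of the disk. *)

Definition cder (f : C -> C) (z l : C) : Prop :=
  forall eps : R, 0 < eps -> exists d : R, 0 < d /\
    forall w : C, Cmod (w - z) < d ->
      Cmod (f w - f z - l * (w - z)) <= eps * Cmod (w - z).

Definition ccont (f : C -> C) (z : C) : Prop :=
  forall eps : R, 0 < eps -> exists d : R, 0 < d /\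
    forall w : C, Cmod (w - z) < d -> Cmod (f w - f z) < eps.

Lemma is_derive_cder (f : C -> C) (z l : C) :
  @is_derive C_AbsRing C_NormedModule f z l <-> cder f z l.
Proof.
split.
- intros [_ H] eps Heps.
  destruct (H z (fun P HP => HP) (mkposreal eps Heps)) as [d Hd].
  exists d; split; [apply cond_pos|]; intros w Hw.
  specialize (Hd w Hw); simpl in Hd.
  replace (f w - f z - l * (w - z))%C
    with (f w - f z - (w - z) * l)%C by ring.
  exact Hd.
- intros H; split; [apply is_linear_scal_l|].
  intros x Hx eps.
  apply (@is_filter_lim_locally_unique C_AbsRing (AbsRing_NormedModule C_AbsRing)) in Hx; subst x.
  destruct (H eps (cond_pos eps)) as (d & Hd & Hw).
  exists (mkposreal d Hd); intros w Bw; specialize (Hw w Bw).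
  replace (f w - f z - l * (w - z))%C
    with (f w - f z - (w - z) * l)%C in Hw by ring.
  exact Hw.
Qed.

Lemma cder_C_derive (f : C -> C) (z l : C) : cder f z l -> C_derive f z = l.
Proof.
intros H; apply is_C_derive_unique; apply is_derive_cder in H; exact H.
Qed.

Lemma analytic_cder (f : C -> C) :
  analyticD f -> forall z, inD z -> cder f z (C_derive f z).
Proof.
intros H z Hz; destruct (H z Hz) as [l Hl].
apply is_derive_cder in Hl; rewrite (cder_C_derive _ _ _ Hl); exact Hl.
Qed.

Lemma cder_analytic (f df : C -> C) :
  (forall z, inD z -> cder f z (df z)) -> analyticD f.
Proof.
intros H z Hz; exists (df z); apply is_derive_cder, H, Hz.
Qed.

Lemma Cmod_sub_sym (a b : C) : Cmod (a - b) = Cmod (b - a).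
Proof. rewrite <- Cmod_opp; f_equal; ring. Qed.

Lemma Cmod_le_sub (a b : C) : Cmod a <= Cmod b + Cmod (a - b).
Proof.
replace a with (b + (a - b))%C at 1 by ring; apply Cmod_triangle.
Qed.

Lemma Cmod_pos_nz (a : C) : 0 < Cmod a -> a <> RtoC 0.
Proof. intros H ->; rewrite Cmod_0 in H; lra. Qed.

Lemma cder_ext_loc (f g : C -> C) (z l : C) (d0 : R) :
  0 < d0 -> (forall w, Cmod (w - z) < d0 -> f w = g w) ->
  cder f z l -> cder g z l.
Proof.
intros Hd0 He H eps Heps; destruct (H eps Heps) as (d & Hd & Hw).
exists (Rmin d d0); split; [apply Rmin_pos; assumption|]; intros w Bw.
assert (B1 := Rlt_le_trans _ _ _ Bw (Rmin_l _ _)).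
assert (B2 := Rlt_le_trans _ _ _ Bw (Rmin_r _ _)).
rewrite <- (He w B2), <- (He z); auto.
replace (z - z)%C with (RtoC 0) by ring; rewrite Cmod_0; exact Hd0.
Qed.

Lemma cder_lip (f : C -> C) (z l : C) : cder f z l ->
  exists d, 0 < d /\ forall w, Cmod (w - z) < d ->
    Cmod (f w - f z) <= (Cmod l + 1) * Cmod (w - z).
Proof.
intros H; destruct (H 1 Rlt_0_1) as (d & Hd & Hw).
exists d; split; [exact Hd|]; intros w Bw; specialize (Hw w Bw).
generalize (Cmod_le_sub (f w - f z) (l * (w - z))); rewrite Cmod_mult; lra.
Qed.

Lemma cder_ccont (f : C -> C) (z l : C) : cder f z l -> ccont f z.
Proof.
intros H eps Heps; destruct (cder_lip f z l H) as (d & Hd & Hw).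
assert (Hl := Cmod_ge_0 l).
assert (Hk : 0 < eps / (Cmod l + 1)) by (apply Rdiv_lt_0_compat; lra).
exists (Rmin d (eps / (Cmod l + 1))); split; [apply Rmin_pos; assumption|].
intros w Bw.
assert (B1 := Rlt_le_trans _ _ _ Bw (Rmin_l _ _)).
assert (B2 := Rlt_le_trans _ _ _ Bw (Rmin_r _ _)).
apply Rle_lt_trans with (1 := Hw w B1).
apply Rmult_lt_compat_l with (r := Cmod l + 1) in B2; [|lra].
replace ((Cmod l + 1) * (eps / (Cmod l + 1))) with eps in B2 by (field; lra).
exact B2.
Qed.

Lemma cder_const (c z : C) : cder (fun _ => c) z (RtoC 0).
Proof.
intros eps Heps; exists 1; split; [lra|]; intros w _.
replace (c - c - RtoC 0 * (w - z))%C with (RtoC 0) by ring.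
rewrite Cmod_0; apply Rmult_le_pos; [lra|apply Cmod_ge_0].
Qed.

Lemma cder_id (z : C) : cder (fun w => w) z (RtoC 1).
Proof.
intros eps Heps; exists 1; split; [lra|]; intros w _.
replace (w - z - RtoC 1 * (w - z))%C with (RtoC 0) by ring.
rewrite Cmod_0; apply Rmult_le_pos; [lra|apply Cmod_ge_0].
Qed.

Lemma cder_eq (f : C -> C) (z l l' : C) : l = l' -> cder f z l -> cder f z l'.
Proof. intros ->; auto. Qed.

Lemma cder_plus (f g : C -> C) (z l m : C) :
  cder f z l -> cder g z m -> cder (fun w => f w + g w)%C z (l + m)%C.
Proof.
intros Hf Hg eps Heps.
destruct (Hf (eps / 2)) as (d1 & Hd1 & H1); [lra|].
destruct (Hg (eps / 2)) as (d2 & Hd2 & H2); [lra|].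
exists (Rmin d1 d2); split; [apply Rmin_pos; assumption|]; intros w Bw.
assert (B1 := H1 w (Rlt_le_trans _ _ _ Bw (Rmin_l _ _))).
assert (B2 := H2 w (Rlt_le_trans _ _ _ Bw (Rmin_r _ _))).
replace (f w + g w - (f z + g z) - (l + m) * (w - z))%C
  with ((f w - f z - l * (w - z)) + (g w - g z - m * (w - z)))%C by ring.
generalize (Cmod_triangle (f w - f z - l * (w - z)) (g w - g z - m * (w - z))).
lra.
Qed.

Lemma cder_mult (f g : C -> C) (z l m : C) :
  cder f z l -> cder g z m ->
  cder (fun w => f w * g w)%C z (l * g z + f z * m)%C.
Proof.
intros Hf Hg eps Heps.
destruct (cder_lip f z l Hf) as (d1 & Hd1 & L1).
destruct (cder_lip g z m Hg) as (d2 & Hd2 & L2).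
set (A := Cmod l + 1) in *; set (B := Cmod m + 1) in *.
assert (HA : 0 < A) by (generalize (Cmod_ge_0 l); unfold A; lra).
assert (HB : 0 < B) by (generalize (Cmod_ge_0 m); unfold B; lra).
assert (Hfz := Cmod_ge_0 (f z)); assert (Hgz := Cmod_ge_0 (g z)).
assert (HAB := Rmult_lt_0_compat _ _ HA HB).
set (k := Cmod (f z) + Cmod (g z) + A * B).
assert (Hk : 0 < k) by (unfold k; lra).
assert (He : 0 < eps / k) by (apply Rdiv_lt_0_compat; lra).
destruct (Hf _ He) as (d3 & Hd3 & H3).
destruct (Hg _ He) as (d4 & Hd4 & H4).
exists (Rmin (Rmin d1 d2) (Rmin (Rmin d3 d4) (eps / k))).
split; [repeat apply Rmin_pos; assumption|]; intros w Bw.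
assert (Ba := Rlt_le_trans _ _ _ Bw (Rmin_l _ _)).
assert (Bb := Rlt_le_trans _ _ _ Bw (Rmin_r _ _)).
assert (Bc := Rlt_le_trans _ _ _ Bb (Rmin_l _ _)).
specialize (L1 w (Rlt_le_trans _ _ _ Ba (Rmin_l _ _))).
specialize (L2 w (Rlt_le_trans _ _ _ Ba (Rmin_r _ _))).
specialize (H3 w (Rlt_le_trans _ _ _ Bc (Rmin_l _ _))).
specialize (H4 w (Rlt_le_trans _ _ _ Bc (Rmin_r _ _))).
assert (H5 := Rlt_le_trans _ _ _ Bb (Rmin_r _ _)).
set (e := eps / k) in *; set (h := Cmod (w - z)) in *.
assert (Hh : 0 <= h) by apply Cmod_ge_0.
replace (f w * g w - f z * g z - (l * g z + f z * m) * (w - z))%C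
  with ((f w - f z - l * (w - z)) * g z + f z * (g w - g z - m * (w - z))
        + (f w - f z) * (g w - g z))%C by ring.
eapply Rle_trans; [apply Cmod_triangle|].
eapply Rle_trans; [apply Rplus_le_compat_r, Cmod_triangle|].
rewrite !Cmod_mult.
replace eps with (e * k) by (unfold e; field; lra).
apply Rle_trans with (e * h * Cmod (g z) + Cmod (f z) * (e * h)
  + (A * h) * (B * h)).
- apply Rplus_le_compat; [apply Rplus_le_compat|].
  + apply Rmult_le_compat_r; assumption.
  + apply Rmult_le_compat_l; assumption.
  + apply Rmult_le_compat; try assumption; apply Cmod_ge_0.
- assert (A * B * h * h <= A * B * h * e).
  { apply Rmult_le_compat_l; [|lra]; apply Rmult_le_pos; lra. }
  unfold k; nra.
Qed.

Lemma cder_comp (f g : C -> C) (z l m : C) :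
  cder f (g z) l -> cder g z m -> cder (fun w => f (g w)) z (l * m)%C.
Proof.
intros Hf Hg eps Heps.
destruct (cder_lip g z m Hg) as (d1 & Hd1 & L1).
set (B := Cmod m + 1) in *.
assert (HB : 0 < B) by (generalize (Cmod_ge_0 m); unfold B; lra).
assert (Hl := Cmod_ge_0 l).
set (k := B + Cmod l).
assert (Hk : 0 < k) by (unfold k; lra).
assert (He : 0 < eps / k) by (apply Rdiv_lt_0_compat; lra).
destruct (Hf _ He) as (d2 & Hd2 & H2).
destruct (Hg _ He) as (d3 & Hd3 & H3).
destruct (cder_ccont g z m Hg d2 Hd2) as (d4 & Hd4 & H4).
exists (Rmin (Rmin d1 d3) d4); split; [repeat apply Rmin_pos; assumption|].
intros w Bw.
assert (Ba := Rlt_le_trans _ _ _ Bw (Rmin_l _ _)).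
specialize (H4 w (Rlt_le_trans _ _ _ Bw (Rmin_r _ _))).
specialize (L1 w (Rlt_le_trans _ _ _ Ba (Rmin_l _ _))).
specialize (H3 w (Rlt_le_trans _ _ _ Ba (Rmin_r _ _))).
specialize (H2 (g w) H4).
set (e := eps / k) in *; set (h := Cmod (w - z)) in *.
replace (f (g w) - f (g z) - l * m * (w - z))%C
  with ((f (g w) - f (g z) - l * (g w - g z))
        + l * (g w - g z - m * (w - z)))%C by ring.
eapply Rle_trans; [apply Cmod_triangle|]; rewrite Cmod_mult.
replace eps with (e * k) by (unfold e; field; lra).
apply Rmult_le_compat_l with (r := e) in L1; [|lra].
apply Rmult_le_compat_l with (r := Cmod l) in H3; [|lra].
unfold k; nra.
Qed.

Lemma cder_inv_id (z : C) : z <> RtoC 0 -> cder Cinv z (- / (z * z))%C.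
Proof.
intros Hz eps Heps; assert (Hm := Cmod_gt_0 z).
assert (Hz0 : 0 < Cmod z) by (apply Hm; exact Hz).
assert (Hc : 0 < Cmod z * Cmod z * Cmod z) by (repeat apply Rmult_lt_0_compat; lra).
assert (Hc2 : 0 < eps * (Cmod z * Cmod z * Cmod z) / 2)
  by (apply Rmult_lt_0_compat; [apply Rmult_lt_0_compat|]; lra).
exists (Rmin (Cmod z / 2) (eps * (Cmod z * Cmod z * Cmod z) / 2)).
split; [apply Rmin_pos; [lra|exact Hc2]|]; intros w Bw.
assert (B1 := Rlt_le_trans _ _ _ Bw (Rmin_l _ _)).
assert (B2 := Rlt_le_trans _ _ _ Bw (Rmin_r _ _)).
assert (Hw : Cmod z / 2 < Cmod w).
{ generalize (Cmod_le_sub z w); rewrite Cmod_sub_sym; lra. }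
assert (Hw0 : w <> RtoC 0) by (apply Cmod_pos_nz; lra).
replace (/ w - / z - - / (z * z) * (w - z))%C
  with ((w - z) * ((w - z) / (w * (z * z))))%C by (field; split; assumption).
rewrite Cmod_mult, Rmult_comm; apply Rmult_le_compat_r; [apply Cmod_ge_0|].
rewrite Cmod_div, !Cmod_mult by (repeat apply Cmult_neq_0; assumption).
apply Rmult_le_reg_r with (Cmod w * (Cmod z * Cmod z)); [nra|].
replace (Cmod (w - z) / (Cmod w * (Cmod z * Cmod z)) *
  (Cmod w * (Cmod z * Cmod z))) with (Cmod (w - z)) by (field; split; lra).
apply Rle_trans with (eps * (Cmod z * Cmod z * Cmod z) / 2); [lra|].
assert (0 < eps * (Cmod z * Cmod z)) by (apply Rmult_lt_0_compat; nra).
nra.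
Qed.

Lemma cder_opp (f : C -> C) (z l : C) :
  cder f z l -> cder (fun w => - f w)%C z (- l)%C.
Proof.
intros H.
apply cder_ext_loc with (f := fun w => (- RtoC 1 * f w)%C) (d0 := 1); [lra| |].
- intros w _; ring.
- apply cder_eq with (RtoC 0 * f z + - RtoC 1 * l)%C; [ring|].
  exact (cder_mult (fun _ => - RtoC 1)%C f z _ _ (cder_const _ _) H).
Qed.

Lemma cder_minus (f g : C -> C) (z l m : C) :
  cder f z l -> cder g z m -> cder (fun w => f w - g w)%C z (l - m)%C.
Proof.
intros Hf Hg; exact (cder_plus f _ z l _ Hf (cder_opp g z m Hg)).
Qed.

Lemma cder_inv (f : C -> C) (z l : C) : f z <> RtoC 0 ->
  cder f z l -> cder (fun w => / f w)%C z (- l / (f z * f z))%C.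
Proof.
intros Hz Hf; apply cder_eq with (- / (f z * f z) * l)%C; [field; exact Hz|].
exact (cder_comp Cinv f z _ _ (cder_inv_id _ Hz) Hf).
Qed.

Lemma cder_div (f g : C -> C) (z l m : C) : g z <> RtoC 0 ->
  cder f z l -> cder g z m ->
  cder (fun w => f w / g w)%C z ((l * g z - f z * m) / (g z * g z))%C.
Proof.
intros Hz Hf Hg.
apply cder_eq with (l * / g z + f z * (- m / (g z * g z)))%C; [field; exact Hz|].
exact (cder_mult f _ z l _ Hf (cder_inv g z m Hz Hg)).
Qed.

(* The norms of C as a complex and as a real normed module are different
   terms. *)
Lemma norm_R_Cmod (z : C) : @norm R_AbsRing C_R_NormedModule z = Cmod z.
Proof.
destruct z as [x y]; unfold Cmod, norm; simpl; unfold prod_norm, norm; simpl.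
unfold abs; simpl; f_equal; rewrite !Rmult_1_r.
rewrite <- !Rabs_mult, !Rabs_pos_eq by apply Rle_0_sqr; ring.
Qed.

(** * Restriction to a real parameter, and continuity *)

Lemma cder_is_derive_real (G : C -> C) (t : R) (l : C) :
  cder G (RtoC t) l ->
  @is_derive R_AbsRing C_R_NormedModule (fun s : R => G (RtoC s)) t l.
Proof.
intros H; split; [apply is_linear_scal_l|].
intros x Hx eps.
apply (@is_filter_lim_locally_unique R_AbsRing (AbsRing_NormedModule R_AbsRing)) in Hx; subst x.
destruct (H eps (cond_pos eps)) as (d & Hd & Hw).
exists (mkposreal d Hd); intros s Bs.
change (Rabs (s - t) < d) in Bs.
specialize (Hw (RtoC s)); rewrite <- RtoC_minus, Cmod_R in Hw.
rewrite norm_R_Cmod.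
refine (Rle_trans _ _ _ (Req_le _ _ _) (Hw Bs)); f_equal.
unfold minus, plus, opp, scal; simpl; unfold Cminus, Cplus, Copp, Cmult, RtoC.
unfold prod_scal, prod_plus, prod_opp, scal, plus, opp, mult; simpl.
unfold mult; simpl; f_equal; ring.
Qed.

Lemma ccont_continuous_real (G : C -> C) (t : R) :
  ccont G (RtoC t) ->
  @continuous R_UniformSpace C_R_NormedModule (fun s : R => G (RtoC s)) t.
Proof.
intros H; apply filterlim_locally; intros eps.
destruct (H eps (cond_pos eps)) as (d & Hd & Hw).
exists (mkposreal d Hd); intros s Bs; change (Rabs (s - t) < d) in Bs.
specialize (Hw (RtoC s)); rewrite <- RtoC_minus, Cmod_R in Hw.
specialize (Hw Bs).
split.
- generalize (Rle_lt_trans _ _ _ (Rle_trans _ _ _ (Rmax_l _ _) (Rmax_Cmod _)) Hw).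
  intros H1; exact H1.
- generalize (Rle_lt_trans _ _ _ (Rle_trans _ _ _ (Rmax_r _ _) (Rmax_Cmod _)) Hw).
  intros H1; exact H1.
Qed.

Lemma ccont_mult (f g : C -> C) (z : C) :
  ccont f z -> ccont g z -> ccont (fun w => f w * g w)%C z.
Proof.
intros Hf Hg eps Heps.
set (k := Cmod (f z) + Cmod (g z) + 1).
assert (Hfz := Cmod_ge_0 (f z)); assert (Hgz := Cmod_ge_0 (g z)).
assert (Hk : 0 < k) by (unfold k; lra).
assert (He0 : 0 < eps / k) by (apply Rdiv_lt_0_compat; lra).
set (e := Rmin 1 (eps / k)).
assert (He : 0 < e) by (apply Rmin_pos; lra).
assert (He1 : e <= 1) by apply Rmin_l.
assert (Hek : e * k <= eps).
{ apply Rle_trans with (eps / k * k); [|right; field; lra].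
  apply Rmult_le_compat_r; [lra|apply Rmin_r]. }
destruct (Hf e He) as (d1 & Hd1 & H1).
destruct (Hg e He) as (d2 & Hd2 & H2).
exists (Rmin d1 d2); split; [apply Rmin_pos; assumption|]; intros w Bw.
specialize (H1 w (Rlt_le_trans _ _ _ Bw (Rmin_l _ _))).
specialize (H2 w (Rlt_le_trans _ _ _ Bw (Rmin_r _ _))).
replace (f w * g w - f z * g z)%C with
  ((f w - f z) * g z + f z * (g w - g z) + (f w - f z) * (g w - g z))%C by ring.
eapply Rle_lt_trans; [apply Cmod_triangle|].
eapply Rle_lt_trans; [apply Rplus_le_compat_r, Cmod_triangle|].
rewrite !Cmod_mult.
assert (P1 := Cmod_ge_0 (f w - f z)); assert (P2 := Cmod_ge_0 (g w - g z)).
unfold k in Hek; nra.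
Qed.

Lemma ccont_comp (f g : C -> C) (z : C) :
  ccont f (g z) -> ccont g z -> ccont (fun w => f (g w)) z.
Proof.
intros Hf Hg eps Heps.
destruct (Hf eps Heps) as (d1 & Hd1 & H1).
destruct (Hg d1 Hd1) as (d2 & Hd2 & H2).
exists d2; auto.
Qed.

(** * Goursat's theorem *)

(** The integrand is a function of a complex variable restricted to the real axis. Parametrisations
    such as [circ] are entire, so that [cder] and [ccont] serve for curves as well as for the
    functions integrated along them. *)
Definition CInt (G : C -> C) (a b : R) : C :=
  @RInt C_R_CompleteNormedModule (fun t => G (RtoC t)) a b.

Definition cont_on (G : C -> C) (a b : R) : Prop :=
  forall t : R, a <= t <= b -> ccont G (RtoC t).

Lemma cont_on_sub (G : C -> C) (a b a' b' : R) :
  a <= a' -> b' <= b -> cont_on G a b -> cont_on G a' b'.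
Proof. intros Ha Hb H t Ht; apply H; lra. Qed.

Lemma CInt_correct (G : C -> C) (a b : R) : a <= b -> cont_on G a b ->
  @is_RInt C_R_NormedModule (fun t => G (RtoC t)) a b (CInt G a b).
Proof.
intros Hab H.
apply (@RInt_correct C_R_CompleteNormedModule).
apply (@ex_RInt_continuous C_R_CompleteNormedModule); intros t Ht.
rewrite Rmin_left, Rmax_right in Ht by assumption.
apply (ccont_continuous_real G t), H, Ht.
Qed.

Lemma CInt_unique (G : C -> C) (a b : R) (l : C) :
  @is_RInt C_R_NormedModule (fun t => G (RtoC t)) a b l -> CInt G a b = l.
Proof. exact (@is_RInt_unique C_R_CompleteNormedModule _ a b l). Qed.

Lemma CInt_ext (F G : C -> C) (a b : R) : a <= b ->
  (forall t : R, a <= t <= b -> F (RtoC t) = G (RtoC t)) ->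
  CInt F a b = CInt G a b.
Proof.
intros Hab H; apply (@RInt_ext C_R_CompleteNormedModule); intros t Ht.
rewrite Rmin_left, Rmax_right in Ht by assumption; apply H; lra.
Qed.

Lemma CInt_Chasles (G : C -> C) (a m b : R) : a <= m -> m <= b ->
  cont_on G a b -> CInt G a b = (CInt G a m + CInt G m b)%C.
Proof.
intros H1 H2 H; apply CInt_unique.
apply (@is_RInt_Chasles C_R_NormedModule _ a m b);
 apply CInt_correct; try assumption; eapply cont_on_sub; try apply H; lra.
Qed.

Lemma CInt_minus (F G : C -> C) (a b : R) : a <= b ->
  cont_on F a b -> cont_on G a b ->
  CInt (fun t => F t - G t)%C a b = (CInt F a b - CInt G a b)%C.
Proof.
intros Hab HF HG; apply CInt_unique.
exact (@is_RInt_minus C_R_NormedModule _ _ a b _ _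
  (CInt_correct F a b Hab HF) (CInt_correct G a b Hab HG)).
Qed.

Lemma CInt_scal (c : C) (G : C -> C) (a b : R) : a <= b ->
  cont_on G a b ->
  CInt (fun t => c * G t)%C a b = (c * CInt G a b)%C.
Proof.
intros Hab HG; apply CInt_unique.
assert (H := CInt_correct G a b Hab HG).
assert (H1 := is_RInt_fct_extend_fst _ a b _ H).
assert (H2 := is_RInt_fct_extend_snd _ a b _ H).
destruct c as [x y]; apply is_RInt_fct_extend_pair; simpl.
- apply (is_RInt_minus (V := R_NormedModule)); apply (is_RInt_scal (V := R_NormedModule)); assumption.
- apply (is_RInt_plus (V := R_NormedModule)); apply (is_RInt_scal (V := R_NormedModule)); assumption.
Qed.

Lemma CInt_const (c : C) (a b : R) :
  CInt (fun _ => c) a b = (RtoC (b - a) * c)%C.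
Proof.
apply CInt_unique.
replace (RtoC (b - a) * c)%C
  with (@scal R_Ring C_R_NormedModule (b - a) c).
- apply is_RInt_const.
- destruct c as [x y]; unfold RtoC, Cmult, scal; simpl.
  unfold prod_scal, scal; simpl; unfold mult; simpl; f_equal; ring.
Qed.

Lemma CInt_bound (G : C -> C) (a b M : R) : a <= b ->
  cont_on G a b -> (forall t : R, a <= t <= b -> Cmod (G (RtoC t)) <= M) ->
  Cmod (CInt G a b) <= (b - a) * M.
Proof.
intros Hab HG HM; rewrite <- norm_R_Cmod.
apply (@norm_RInt_le_const C_R_NormedModule (fun t => G (RtoC t)) a b _ M Hab).
- intros t Ht; rewrite norm_R_Cmod; apply HM, Ht.
- apply CInt_correct; assumption.
Qed.

Lemma CInt_FTC (G g : C -> C) (a b : R) : a <= b ->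
  (forall t : R, a <= t <= b -> cder G (RtoC t) (g (RtoC t))) ->
  cont_on g a b -> CInt g a b = (G (RtoC b) - G (RtoC a))%C.
Proof.
intros Hab HG Hg; apply CInt_unique.
apply (@is_RInt_derive C_R_CompleteNormedModule (fun t => G (RtoC t))
  (fun t => g (RtoC t)) a b); intros t Ht;
  rewrite Rmin_left, Rmax_right in Ht by assumption.
- apply (cder_is_derive_real G), HG, Ht.
- apply (ccont_continuous_real g), Hg, Ht.
Qed.

Lemma cder_lipschitz (G g : C -> C) (a b M : R) :
  (forall t : R, a <= t <= b -> cder G (RtoC t) (g (RtoC t))) ->
  cont_on g a b -> (forall t : R, a <= t <= b -> Cmod (g (RtoC t)) <= M) ->
  forall x y : R, a <= x <= b -> a <= y <= b ->
    Cmod (G (RtoC x) - G (RtoC y)) <= M * Rabs (x - y).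
Proof.
intros HG Hg HM.
assert (W : forall x y : R, a <= x <= b -> a <= y <= b -> x <= y ->
  Cmod (G (RtoC y) - G (RtoC x)) <= M * (y - x)).
{ intros x y Hx Hy Hxy.
  rewrite <- (CInt_FTC G g x y Hxy).
  - rewrite Rmult_comm; apply CInt_bound; [exact Hxy| |].
    + intros t Ht; apply Hg; lra.
    + intros t Ht; apply HM; lra.
  - intros t Ht; apply HG; lra.
  - intros t Ht; apply Hg; lra. }
intros x y Hx Hy; destruct (Rle_dec x y) as [Hxy|Hxy].
- rewrite Cmod_sub_sym, Rabs_minus_sym, Rabs_pos_eq by lra; apply W; lra.
- rewrite Rabs_pos_eq by lra; apply W; lra.
Qed.

(* Comparison of an integral along an edge with that of the affine
   approximation of [F] at [z0], whose primitive is explicit. *)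
Lemma edge_estimate (F g g' : C -> C) (F0 l z0 : C) (a b K M : R) :
  a <= b -> 0 <= K ->
  (forall t : R, a <= t <= b -> cder g (RtoC t) (g' (RtoC t))) ->
  cont_on g' a b -> cont_on (fun t => F (g t)) a b ->
  (forall t : R, a <= t <= b -> Cmod (g' (RtoC t)) <= M) ->
  (forall t : R, a <= t <= b ->
     Cmod (F (g (RtoC t)) - F0 - l * (g (RtoC t) - z0)) <= K) ->
  let P := fun z => (F0 * z + l / (1 + 1) * ((z - z0) * (z - z0)))%C in
  Cmod (CInt (fun t => F (g t) * g' t)%C a b
        - (P (g (RtoC b)) - P (g (RtoC a)))) <= (b - a) * (K * M).
Proof.
intros Hab HK Hg Hg' HF HM HE P.
assert (Hgc : cont_on g a b) by (intros t Ht; eapply cder_ccont, Hg, Ht).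
assert (HP : forall z, cder P z (F0 + l * (z - z0))%C).
{ intros z; unfold P.
  eapply cder_eq; [|apply cder_plus].
  2: apply cder_mult; [apply cder_const|apply cder_id].
  2: apply cder_mult; [apply cder_const|apply cder_mult; apply cder_minus;
       try apply cder_id; apply cder_const].
  cbv beta; field; rewrite <- RtoC_plus; intros H; apply RtoC_inj in H; lra. }
set (Q := fun z => (F0 + l * (z - z0))%C).
assert (HQ : cont_on (fun t => Q (g t) * g' t)%C a b).
{ intros t Ht; apply ccont_mult; [|apply Hg', Ht].
  apply ccont_comp; [|apply Hgc, Ht].
  eapply cder_ccont; unfold Q; apply cder_plus; [apply cder_const|].
  apply cder_mult; [apply cder_const|apply cder_minus; [apply cder_id|apply cder_const]]. }
assert (HFg : cont_on (fun t => F (g t) * g' t)%C a b).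
{ intros t Ht; apply ccont_mult; [apply HF, Ht|apply Hg', Ht]. }
rewrite <- (CInt_FTC (fun t => P (g t)) (fun t => Q (g t) * g' t)%C a b Hab);
 [|intros t Ht; apply cder_comp; [apply HP|apply Hg, Ht]|exact HQ].
rewrite <- CInt_minus by assumption.
apply CInt_bound; [assumption| |].
- intros t Ht.
  assert (A : ccont (fun z => (F (g z) * g' z + (- RtoC 1) * (Q (g z) * g' z))%C) (RtoC t)).
  { intros eps Heps.
    destruct (HFg t Ht (eps / 2)) as (d1 & Hd1 & H1); [lra|].
    destruct (HQ t Ht (eps / 2)) as (d2 & Hd2 & H2); [lra|].
    exists (Rmin d1 d2); split; [apply Rmin_pos; assumption|]; intros w Bw.
    specialize (H1 w (Rlt_le_trans _ _ _ Bw (Rmin_l _ _))).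
    specialize (H2 w (Rlt_le_trans _ _ _ Bw (Rmin_r _ _))).
    rewrite Cmod_sub_sym in H2.
    match goal with |- Cmod ?x < _ => replace x with
      ((F (g w) * g' w - F (g (RtoC t)) * g' (RtoC t)) +
       (Q (g (RtoC t)) * g' (RtoC t) - Q (g w) * g' w))%C by ring end.
    eapply Rle_lt_trans; [apply Cmod_triangle|lra]. }
  intros eps Heps; destruct (A eps Heps) as (d & Hd & H); exists d; split; [exact Hd|].
  intros w Bw; specialize (H w Bw).
  match goal with H : Cmod ?x < _ |- Cmod ?y < _ => replace y with x by ring end.
  exact H.
- intros t Ht.
  replace (F (g (RtoC t)) * g' (RtoC t) - Q (g (RtoC t)) * g' (RtoC t))%C with
   ((F (g (RtoC t)) - F0 - l * (g (RtoC t) - z0)) * g' (RtoC t))%C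
   by (unfold Q; ring).
  rewrite Cmod_mult; apply Rmult_le_compat; try apply Cmod_ge_0;
   [apply HE, Ht|apply HM, Ht].
Qed.

(** The supremum of the left end points lies in all the nested intervals [a n, a n + l n]. *)
Lemma nested_limit (a l : nat -> R) :
  (forall n, a n <= a (S n)) -> (forall n, a (S n) + l (S n) <= a n + l n) ->
  (forall n, 0 <= l n) -> exists s, forall n, a n <= s <= a n + l n.
Proof.
intros Ha Hb Hl.
assert (Ha' : forall k n, a n <= a (n + k)%nat).
{ induction k; intros n; [rewrite Nat.add_0_r; lra|].
  rewrite Nat.add_succ_r; generalize (IHk n) (Ha (n + k)%nat); lra. }
assert (Hb' : forall k n, a (n + k)%nat + l (n + k)%nat <= a n + l n).
{ induction k; intros n; [rewrite Nat.add_0_r; lra|].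
  rewrite Nat.add_succ_r; generalize (IHk n) (Hb (n + k)%nat); lra. }
assert (Hu : forall n m, a n <= a m + l m).
{ intros n m; generalize (Ha' m n) (Hb' n m) (Hl (m + n)%nat).
  rewrite (Nat.add_comm n m); lra. }
destruct (completeness (fun x => exists n, x = a n)) as [s [Hs1 Hs2]].
- exists (a O + l O); intros x [n ->]; apply Hu.
- exists (a O), O; reflexivity.
- exists s; intros n; split; [apply Hs1; exists n; reflexivity|].
  apply Hs2; intros x [m ->]; apply Hu.
Qed.

(** The rectangle of stage n has lower left corner (a, c) and sides l1 / 2^n and l2 / 2^n; passing
    to a quarter keeps each coordinate of the corner or moves it by half a side. The choice of a
    quarter is made into a function on corners satisfying [P], so that recursion yields the whole
    sequence. *)
Lemma bisection_limit (P : nat -> R -> R -> Prop) (a0 c0 l1 l2 : R) :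
  0 <= l1 -> 0 <= l2 -> P O a0 c0 ->
  (forall n a c, P n a c -> exists a' c',
     (a' = a \/ a' = a + l1 / 2 ^ S n) /\ (c' = c \/ c' = c + l2 / 2 ^ S n) /\
     P (S n) a' c') ->
  exists s t, forall n, exists a c, P n a c /\
     a <= s <= a + l1 / 2 ^ n /\ c <= t <= c + l2 / 2 ^ n.
Proof.
intros Hl1 Hl2 H0 Hstep.
set (T := fun n => {p : R * R | P n (fst p) (snd p)}).
assert (step : forall n (p : T n), {q : T (S n) |
  (fst (proj1_sig q) = fst (proj1_sig p) \/
   fst (proj1_sig q) = fst (proj1_sig p) + l1 / 2 ^ S n) /\
  (snd (proj1_sig q) = snd (proj1_sig p) \/
   snd (proj1_sig q) = snd (proj1_sig p) + l2 / 2 ^ S n)}).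
{ intros n [[a c] Hp]; apply constructive_indefinite_description.
  destruct (Hstep n a c Hp) as (a' & c' & Ha & Hc & HP).
  exists (exist _ (a', c') HP); simpl; auto. }
set (u := fix u n : T n := match n with
  | O => exist _ (a0, c0) H0
  | S m => proj1_sig (step m (u m)) end).
set (a := fun n => fst (proj1_sig (u n))).
set (c := fun n => snd (proj1_sig (u n))).
assert (Hac : forall n, (a (S n) = a n \/ a (S n) = a n + l1 / 2 ^ S n) /\
  (c (S n) = c n \/ c (S n) = c n + l2 / 2 ^ S n)).
{ intros n; exact (proj2_sig (step n (u n))). }
assert (Hh : forall l n, l / 2 ^ n = 2 * (l / 2 ^ S n)).
{ intros l n; simpl; field; apply pow_nonzero; lra. }
assert (Hp : forall l n, 0 <= l -> 0 <= l / 2 ^ n).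
{ intros l n Hl; apply Rmult_le_pos; [exact Hl|].
  left; apply Rinv_0_lt_compat, pow_lt; lra. }
destruct (nested_limit a (fun n => l1 / 2 ^ n)) as [s Hs].
- intros n; destruct (Hac n) as [Ha _]; generalize (Hp l1 (S n) Hl1); lra.
- intros n; destruct (Hac n) as [Ha _]; generalize (Hp l1 (S n) Hl1) (Hh l1 n); lra.
- intros n; apply Hp, Hl1.
- destruct (nested_limit c (fun n => l2 / 2 ^ n)) as [t Ht].
  + intros n; destruct (Hac n) as [_ Hc]; generalize (Hp l2 (S n) Hl2); lra.
  + intros n; destruct (Hac n) as [_ Hc]; generalize (Hp l2 (S n) Hl2) (Hh l2 n); lra.
  + intros n; apply Hp, Hl2.
  + exists s, t; intros n; exists (a n), (c n).
    split; [exact (proj2_sig (u n))|split; [apply Hs|apply Ht]].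
Qed.

(** The integral of F dz along the image under [H] of the boundary of [a, b] x [c, d], taken
    counterclockwise; [Hs] and [Ht] stand for the partial derivatives of [H]. *)
Definition boundary (F : C -> C) (H Hs Ht : C -> C -> C) (a b c d : R) : C :=
  (CInt (fun u => F (H u (RtoC c)) * Hs u (RtoC c)) a b
   + CInt (fun u => F (H (RtoC b) u) * Ht (RtoC b) u) c d
   - CInt (fun u => F (H u (RtoC d)) * Hs u (RtoC d)) a b
   - CInt (fun u => F (H (RtoC a) u) * Ht (RtoC a) u) c d)%C.

Section Goursat.

Variables (F : C -> C) (H Hs Ht : C -> C -> C) (a0 b0 c0 d0 M : R).
Hypothesis Hab : a0 <= b0.
Hypothesis Hcd : c0 <= d0.
Hypothesis HS : forall s t : R, a0 <= s <= b0 -> c0 <= t <= d0 ->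
  cder (fun u => H u (RtoC t)) (RtoC s) (Hs (RtoC s) (RtoC t)).
Hypothesis HT : forall s t : R, a0 <= s <= b0 -> c0 <= t <= d0 ->
  cder (fun u => H (RtoC s) u) (RtoC t) (Ht (RtoC s) (RtoC t)).
Hypothesis HSc : forall s t : R, a0 <= s <= b0 -> c0 <= t <= d0 ->
  ccont (fun u => Hs u (RtoC t)) (RtoC s).
Hypothesis HTc : forall s t : R, a0 <= s <= b0 -> c0 <= t <= d0 ->
  ccont (fun u => Ht (RtoC s) u) (RtoC t).
Hypothesis HM : forall s t : R, a0 <= s <= b0 -> c0 <= t <= d0 ->
  Cmod (Hs (RtoC s) (RtoC t)) <= M /\ Cmod (Ht (RtoC s) (RtoC t)) <= M.
Hypothesis HF : forall s t : R, a0 <= s <= b0 -> c0 <= t <= d0 ->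
  exists l, cder F (H (RtoC s) (RtoC t)) l.

Lemma horizontal_cont (s t : R) : a0 <= s <= b0 -> c0 <= t <= d0 ->
  ccont (fun u => F (H u (RtoC t))) (RtoC s).
Proof.
intros Hs' Ht'; destruct (HF s t Hs' Ht') as [l Hl].
apply (ccont_comp F (fun u => H u (RtoC t))).
- exact (cder_ccont _ _ _ Hl).
- exact (cder_ccont _ _ _ (HS s t Hs' Ht')).
Qed.

Lemma vertical_cont (s t : R) : a0 <= s <= b0 -> c0 <= t <= d0 ->
  ccont (fun u => F (H (RtoC s) u)) (RtoC t).
Proof.
intros Hs' Ht'; destruct (HF s t Hs' Ht') as [l Hl].
apply (ccont_comp F (fun u => H (RtoC s) u)).
- exact (cder_ccont _ _ _ Hl).
- exact (cder_ccont _ _ _ (HT s t Hs' Ht')).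
Qed.

Lemma horizontal_split (a m b t : R) :
  a0 <= a -> a <= m -> m <= b -> b <= b0 -> c0 <= t <= d0 ->
  CInt (fun u => F (H u (RtoC t)) * Hs u (RtoC t))%C a b =
  (CInt (fun u => F (H u (RtoC t)) * Hs u (RtoC t)) a m +
   CInt (fun u => F (H u (RtoC t)) * Hs u (RtoC t)) m b)%C.
Proof.
intros; apply CInt_Chasles; try assumption.
intros s Hs'; apply ccont_mult; [apply horizontal_cont|apply HSc]; lra.
Qed.

Lemma vertical_split (c m d s : R) :
  c0 <= c -> c <= m -> m <= d -> d <= d0 -> a0 <= s <= b0 ->
  CInt (fun u => F (H (RtoC s) u) * Ht (RtoC s) u)%C c d =
  (CInt (fun u => F (H (RtoC s) u) * Ht (RtoC s) u) c m +
   CInt (fun u => F (H (RtoC s) u) * Ht (RtoC s) u) m d)%C.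
Proof.
intros; apply CInt_Chasles; try assumption.
intros t Ht'; apply ccont_mult; [apply vertical_cont|apply HTc]; lra.
Qed.

(** Every inner edge is run through twice, in opposite directions. *)
Lemma boundary_split (a m b c n d : R) :
  a0 <= a -> a <= m -> m <= b -> b <= b0 ->
  c0 <= c -> c <= n -> n <= d -> d <= d0 ->
  boundary F H Hs Ht a b c d =
  (boundary F H Hs Ht a m c n + boundary F H Hs Ht m b c n +
   boundary F H Hs Ht a m n d + boundary F H Hs Ht m b n d)%C.
Proof.
intros; unfold boundary.
rewrite (horizontal_split a m b c), (horizontal_split a m b d),
  (vertical_split c n d a), (vertical_split c n d b) by lra.
ring.
Qed.

(** The affine function F0 + l (z - z0) has the primitive [P], whose values at the four corners
    cancel around the rectangle. Only the approximation errors along the four edges remain. *)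
Lemma boundary_estimate (a b c d K : R) (F0 l z0 : C) :
  a0 <= a -> a <= b -> b <= b0 -> c0 <= c -> c <= d -> d <= d0 -> 0 <= K ->
  (forall s t, a <= s <= b -> c <= t <= d ->
    Cmod (F (H (RtoC s) (RtoC t)) - F0 - l * (H (RtoC s) (RtoC t) - z0)) <= K) ->
  Cmod (boundary F H Hs Ht a b c d) <= 2 * ((b - a) + (d - c)) * (K * M).
Proof.
intros Ha Hab' Hb Hc Hcd' Hd HK HE.
assert (Eh : forall t, c <= t <= d -> let P := fun z => (F0 * z + l / (1 + 1) * ((z - z0) * (z - z0)))%C in
  Cmod (CInt (fun u => F (H u (RtoC t)) * Hs u (RtoC t))%C a b
    - (P (H (RtoC b) (RtoC t)) - P (H (RtoC a) (RtoC t)))) <= (b - a) * (K * M)).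
{ intros t Ht'.
  apply (edge_estimate F (fun u => H u (RtoC t)) (fun u => Hs u (RtoC t)));
    try assumption.
  - intros s Hs'; apply HS; lra.
  - intros s Hs'; apply HSc; lra.
  - intros s Hs'; apply horizontal_cont; lra.
  - intros s Hs'; apply HM; lra.
  - intros s Hs'; apply HE; lra. }
assert (Ev : forall s, a <= s <= b -> let P := fun z => (F0 * z + l / (1 + 1) * ((z - z0) * (z - z0)))%C in
  Cmod (CInt (fun u => F (H (RtoC s) u) * Ht (RtoC s) u)%C c d
    - (P (H (RtoC s) (RtoC d)) - P (H (RtoC s) (RtoC c)))) <= (d - c) * (K * M)).
{ intros s Hs'.
  apply (edge_estimate F (fun u => H (RtoC s) u) (fun u => Ht (RtoC s) u));
    try assumption.
  - intros t Ht'; apply HT; lra.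
  - intros t Ht'; apply HTc; lra.
  - intros t Ht'; apply vertical_cont; lra.
  - intros t Ht'; apply HM; lra.
  - intros t Ht'; apply HE; lra. }
assert (E1 := Eh c); assert (E2 := Ev b); assert (E3 := Eh d); assert (E4 := Ev a).
clear Eh Ev; cbv zeta in *.
specialize (E1 ltac:(lra)); specialize (E2 ltac:(lra)).
specialize (E3 ltac:(lra)); specialize (E4 ltac:(lra)).
unfold boundary.
match type of E1 with Cmod ?x <= _ => set (x1 := x) in * end.
match type of E2 with Cmod ?x <= _ => set (x2 := x) in * end.
match type of E3 with Cmod ?x <= _ => set (x3 := x) in * end.
match type of E4 with Cmod ?x <= _ => set (x4 := x) in * end.
match goal with |- Cmod ?x <= _ => replace x with (x1 + x2 + - x3 + - x4)%C
  by (unfold x1, x2, x3, x4; ring) end.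
generalize (Cmod_triangle (x1 + x2 + - x3) (- x4))
  (Cmod_triangle (x1 + x2) (- x3)) (Cmod_triangle x1 x2).
rewrite !Cmod_opp; lra.
Qed.

(** Ensures that the images of small parameter rectangles are small, so that they enter the
    neighbourhood where the derivative of [F] controls the error. *)
Lemma param_lipschitz (s t s' t' : R) :
  a0 <= s <= b0 -> c0 <= t <= d0 -> a0 <= s' <= b0 -> c0 <= t' <= d0 ->
  Cmod (H (RtoC s) (RtoC t) - H (RtoC s') (RtoC t'))
  <= M * (Rabs (s - s') + Rabs (t - t')).
Proof.
intros Hs1 Ht1 Hs2 Ht2.
assert (E1 : Cmod (H (RtoC s) (RtoC t) - H (RtoC s') (RtoC t)) <= M * Rabs (s - s')).
{ apply (cder_lipschitz (fun u => H u (RtoC t)) (fun u => Hs u (RtoC t)) a0 b0);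
   try assumption.
  - intros x Hx; apply HS; assumption.
  - intros x Hx; apply HSc; assumption.
  - intros x Hx; apply HM; assumption. }
assert (E2 : Cmod (H (RtoC s') (RtoC t) - H (RtoC s') (RtoC t')) <= M * Rabs (t - t')).
{ apply (cder_lipschitz (fun u => H (RtoC s') u) (fun u => Ht (RtoC s') u) c0 d0);
   try assumption.
  - intros x Hx; apply HT; assumption.
  - intros x Hx; apply HTc; assumption.
  - intros x Hx; apply HM; assumption. }
match goal with |- Cmod ?x <= _ => replace x with
 ((H (RtoC s) (RtoC t) - H (RtoC s') (RtoC t)) +
  (H (RtoC s') (RtoC t) - H (RtoC s') (RtoC t')))%C by ring end.
eapply Rle_trans; [apply Cmod_triangle|lra].
Qed.

(** If the integral had modulus eta > 0, repeated quartering would give rectangles shrinking to a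
    point (s, t) whose integrals have modulus at least eta / 4^n. Differentiability of [F] at H(s,
    t) bounds them by an arbitrarily small multiple of 1 / 4^n. *)
Lemma Goursat : boundary F H Hs Ht a0 b0 c0 d0 = RtoC 0.
Proof.
apply Cmod_eq_0.
destruct (Rle_lt_or_eq_dec 0 (Cmod (boundary F H Hs Ht a0 b0 c0 d0)))
  as [Heta|Heta]; [apply Cmod_ge_0| |symmetry; exact Heta].
exfalso; set (eta := Cmod _) in Heta.
set (l1 := b0 - a0); set (l2 := d0 - c0).
set (P := fun n a c => a0 <= a /\ a + l1 / 2 ^ n <= b0 /\
  c0 <= c /\ c + l2 / 2 ^ n <= d0 /\
  eta / 4 ^ n <= Cmod (boundary F H Hs Ht a (a + l1 / 2 ^ n) c (c + l2 / 2 ^ n))).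
assert (Hl1 : 0 <= l1) by (unfold l1; lra).
assert (Hl2 : 0 <= l2) by (unfold l2; lra).
assert (Hh : forall l n, l / 2 ^ n = 2 * (l / 2 ^ S n)).
{ intros l n; simpl; field; apply pow_nonzero; lra. }
assert (Hp : forall l n, 0 <= l -> 0 <= l / 2 ^ n).
{ intros l n Hl; apply Rmult_le_pos; [exact Hl|].
  left; apply Rinv_0_lt_compat, pow_lt; lra. }
destruct (bisection_limit P a0 c0 l1 l2 Hl1 Hl2) as (s & t & Hst).
- unfold P; simpl; unfold Rdiv; rewrite Rinv_1, !Rmult_1_r.
  replace (a0 + l1) with b0 by (unfold l1; ring).
  replace (c0 + l2) with d0 by (unfold l2; ring).
  unfold eta; lra.
- intros n a c (P1 & P2 & P3 & P4 & P5).
  assert (Hn1 := Hh l1 n); assert (Hn2 := Hh l2 n).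
  assert (Hq1 := Hp l1 (S n) Hl1); assert (Hq2 := Hp l2 (S n) Hl2).
  assert (He : eta / 4 ^ n = 4 * (eta / 4 ^ S n)).
  { simpl; field; apply pow_nonzero; lra. }
  set (k1 := l1 / 2 ^ S n) in *; set (k2 := l2 / 2 ^ S n) in *.
  set (e := eta / 4 ^ S n) in *.
  rewrite (boundary_split a (a + k1) (a + l1 / 2 ^ n) c (c + k2) (c + l2 / 2 ^ n)) in P5 by lra.
  replace (a + l1 / 2 ^ n) with (a + k1 + k1) in P5 by lra.
  replace (c + l2 / 2 ^ n) with (c + k2 + k2) in P5 by lra.
  set (B1 := boundary F H Hs Ht a (a + k1) c (c + k2)) in *.
  set (B2 := boundary F H Hs Ht (a + k1) (a + k1 + k1) c (c + k2)) in *.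
  set (B3 := boundary F H Hs Ht a (a + k1) (c + k2) (c + k2 + k2)) in *.
  set (B4 := boundary F H Hs Ht (a + k1) (a + k1 + k1) (c + k2) (c + k2 + k2)) in *.
  assert (T1 := Cmod_triangle (B1 + B2 + B3) B4).
  assert (T2 := Cmod_triangle (B1 + B2) B3).
  assert (T3 := Cmod_triangle B1 B2).
  (* At least one quarter carries a fourth of the lower bound. *)
  assert (D : e <= Cmod B1 \/ e <= Cmod B2 \/ e <= Cmod B3 \/ e <= Cmod B4) by lra.
  unfold P; fold k1 k2 e.
  destruct D as [D|[D|[D|D]]].
  + exists a, c; split; [lra|split; [lra|]]; fold B1; lra.
  + exists (a + k1), c; split; [lra|split; [lra|]]; fold B2; lra.
  + exists a, (c + k2); split; [lra|split; [lra|]]; fold B3; lra.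
  + exists (a + k1), (c + k2); split; [lra|split; [lra|]]; fold B4; lra.
- assert (Hs0 : a0 <= s <= b0 /\ c0 <= t <= d0).
  { destruct (Hst O) as (a & c & (P1 & P2 & P3 & P4 & P5) & Q1 & Q2); lra. }
  destruct Hs0 as [Hs0 Ht0].
  destruct (HF s t Hs0 Ht0) as [l Hl].
  assert (HM0 : 0 <= M).
  { apply Rle_trans with (Cmod (Hs (RtoC s) (RtoC t))); [apply Cmod_ge_0|apply HM; assumption]. }
  set (L := l1 + l2).
  assert (HL : 0 <= L) by (unfold L; lra).
  assert (HML : 0 <= M * L) by (apply Rmult_le_pos; assumption).
  (* With eps = eta / k the upper bound is eta (k - 1) / k times 1 / 4^N, strictly below eta /
     4^N. *)
  set (k := 2 * (M * L) * (M * L) + 1).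
  assert (Hk : 0 < k) by (unfold k; nra).
  assert (Heps : 0 < eta / k) by (apply Rdiv_lt_0_compat; assumption).
  destruct (Hl _ Heps) as (d & Hd & Hw).
  (* The image of the rectangle of stage N stays within M L / 2^N of H(s, t), hence within d. *)
  destruct (pow_lt_1_zero (/ 2) ltac:(rewrite Rabs_pos_eq; lra) (d / (M * L + 1)))
    as [N HN]; [apply Rdiv_lt_0_compat; lra|].
  specialize (HN N (Nat.le_refl N)).
  rewrite Rabs_pos_eq in HN by (apply pow_le; lra).
  rewrite pow_inv in HN.
  destruct (Hst N) as (a & c & (P1 & P2 & P3 & P4 & P5) & Q1 & Q2).
  assert (Hpow : 0 < / 2 ^ N) by (apply Rinv_0_lt_compat, pow_lt; lra).
  set (p := / 2 ^ N) in *.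
  assert (Hq : (M * L + 1) * p < d).
  { apply Rmult_lt_compat_l with (r := M * L + 1) in HN; [|lra].
    replace ((M * L + 1) * (d / (M * L + 1))) with d in HN by (field; lra).
    exact HN. }
  assert (H4 : eta / 4 ^ N = eta * (p * p)).
  { unfold p, Rdiv; rewrite <- Rinv_mult, <- Rpow_mult_distr; do 3 f_equal; ring. }
  unfold Rdiv in Q1, Q2, P2, P4, P5; fold p in Q1, Q2, P2, P4, P5.
  fold (Rdiv eta (4 ^ N)) in P5; rewrite H4 in P5.
  assert (Hlp1 : 0 <= l1 * p) by (apply Rmult_le_pos; lra).
  assert (Hlp2 : 0 <= l2 * p) by (apply Rmult_le_pos; lra).
  set (K := eta / k * (M * L * p)).
  assert (HE := boundary_estimate a (a + l1 * p) c (c + l2 * p) K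
    (F (H (RtoC s) (RtoC t))) l (H (RtoC s) (RtoC t))
    P1 ltac:(lra) P2 P3 ltac:(lra) P4).
  assert (Hfin : eta * (p * p) <=
     2 * (a + l1 * p - a + (c + l2 * p - c)) * (K * M)).
  { apply Rle_trans with (1 := P5); apply HE.
    - apply Rmult_le_pos; [lra|apply Rmult_le_pos; lra].
    - intros s' t' Hs' Ht'.
      assert (Hd1 : Cmod (H (RtoC s') (RtoC t') - H (RtoC s) (RtoC t)) <= M * L * p).
      { eapply Rle_trans; [apply param_lipschitz; lra|].
        rewrite Rmult_assoc; apply Rmult_le_compat_l; [assumption|].
        assert (Rabs (s' - s) <= l1 * p) by (apply Rabs_le; lra).
        assert (Rabs (t' - t) <= l2 * p) by (apply Rabs_le; lra).
        unfold L; lra. }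
      eapply Rle_trans; [apply Hw; lra|].
      unfold K; apply Rmult_le_compat_l; lra. }
  replace (2 * (a + l1 * p - a + (c + l2 * p - c)) * (K * M))
    with (eta / k * (2 * (M * L) * (M * L)) * (p * p)) in Hfin
    by (unfold K, L; ring).
  assert (Hpp : 0 < p * p) by (apply Rmult_lt_0_compat; lra).
  apply Rmult_le_reg_r in Hfin; [|exact Hpp].
  replace (2 * (M * L) * (M * L)) with (k - 1) in Hfin by (unfold k; ring).
  replace (eta / k * (k - 1)) with (eta - eta / k) in Hfin by (field; lra).
  lra.
Qed.

End Goursat.

(** * Integrals over circles *)

Lemma Cexp_plus (z w : C) : Cexp (z + w) = (Cexp z * Cexp w)%C.
Proof.
destruct z as [a b], w as [c d]; unfold Cexp, Cmult, Cplus, Re, Im; simpl.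
rewrite exp_plus, cos_plus, sin_plus; f_equal; ring.
Qed.

Lemma Cexp_0 : Cexp (RtoC 0) = RtoC 1.
Proof.
unfold Cexp, RtoC, Re, Im; simpl; rewrite exp_0, cos_0, sin_0; f_equal; ring.
Qed.

Lemma Cexp_neq_0 (z : C) : Cexp z <> RtoC 0.
Proof.
intros H.
assert (A : (Cexp z * Cexp (- z))%C = RtoC 1).
{ rewrite <- Cexp_plus, Cplus_opp_r; apply Cexp_0. }
rewrite H, Cmult_0_l in A; apply RtoC_inj in A; lra.
Qed.

Lemma derivable_pt_lim_eps (f : R -> R) (x l : R) : derivable_pt_lim f x l ->
  forall eps, 0 < eps -> exists d, 0 < d /\
    forall h, Rabs h < d -> Rabs (f (x + h) - f x - l * h) <= eps * Rabs h.
Proof.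
intros H eps Heps; destruct (H eps Heps) as [d Hd].
exists d; split; [apply cond_pos|]; intros h Hh.
destruct (Req_dec h 0) as [->|Hn].
- rewrite Rplus_0_r; replace (f x - f x - l * 0) with 0 by ring.
  rewrite Rabs_R0; lra.
- specialize (Hd h Hn Hh).
  replace (f (x + h) - f x - l * h) with (((f (x + h) - f x) / h - l) * h)
    by (field; exact Hn).
  rewrite Rabs_mult; apply Rmult_le_compat_r; [apply Rabs_pos|lra].
Qed.

Lemma Cmod_le_Rabs (x y : R) : Cmod (x, y) <= Rabs x + Rabs y.
Proof.
replace (x, y) with (RtoC x + Ci * RtoC y)%C.
- eapply Rle_trans; [apply Cmod_triangle|].
  rewrite Cmod_mult, !Cmod_R, Cmod_Ci; lra.
- unfold RtoC, Ci, Cplus, Cmult; simpl; f_equal; ring.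
Qed.

Lemma cder_Cexp_0 : cder Cexp (RtoC 0) (RtoC 1).
Proof.
intros eps Heps.
(* The four error terms below are bounded by e h, 3 e h, 3 e h and 2 e h, where 3 bounds [exp x];
   their sum is 9 e h. *)
set (e := Rmin 1 (eps / 9)).
assert (He : 0 < e) by (apply Rmin_pos; lra).
assert (He1 : e <= 1) by apply Rmin_l.
assert (He2 : 9 * e <= eps) by (generalize (Rmin_r 1 (eps / 9)); fold e; lra).
destruct (derivable_pt_lim_eps _ _ _ derivable_pt_lim_exp_0 e He) as (d1 & Hd1 & H1).
destruct (derivable_pt_lim_eps _ _ _ derivable_pt_lim_sin_0 e He) as (d2 & Hd2 & H2).
destruct (derivable_pt_lim_eps _ _ _ derivable_pt_lim_cos_0 e He) as (d3 & Hd3 & H3).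
exists (Rmin (Rmin d1 d2) (Rmin d3 e)); split; [apply Rmin_pos; apply Rmin_pos; assumption|].
intros [x y] Bw; replace ((x, y) - RtoC 0)%C with (x, y) in *
  by (unfold RtoC, Cminus, Cplus, Copp; simpl; f_equal; ring).
assert (Ba := Rlt_le_trans _ _ _ Bw (Rmin_l _ _)).
assert (Bb := Rlt_le_trans _ _ _ Bw (Rmin_r _ _)).
assert (B1 := Rlt_le_trans _ _ _ Ba (Rmin_l _ _)).
assert (B2 := Rlt_le_trans _ _ _ Ba (Rmin_r _ _)).
assert (B3 := Rlt_le_trans _ _ _ Bb (Rmin_l _ _)).
assert (B4 := Rlt_le_trans _ _ _ Bb (Rmin_r _ _)).
set (h := Cmod (x, y)) in *.
assert (Hx : Rabs x <= h) by exact (Rle_trans _ _ _ (Rmax_l _ _) (Rmax_Cmod (x, y))).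
assert (Hy : Rabs y <= h) by exact (Rle_trans _ _ _ (Rmax_r _ _) (Rmax_Cmod (x, y))).
specialize (H1 x ltac:(lra)); specialize (H2 y ltac:(lra)); specialize (H3 y ltac:(lra)).
rewrite Rplus_0_l, exp_0 in H1; rewrite Rplus_0_l, sin_0 in H2; rewrite Rplus_0_l, cos_0 in H3.
assert (Hh : 0 <= h) by apply Cmod_ge_0.
assert (P1 := Rabs_pos x); assert (P2 := Rabs_pos y).
assert (H1' : Rabs (exp x - 1 - 1 * x) <= e * h) by nra.
assert (H2' : Rabs (sin y - 0 - 1 * y) <= e * h) by nra.
assert (H3' : Rabs (cos y - 1 - 0 * y) <= e * h) by nra.
assert (Q1 : Rabs (exp x - 1) <= 2 * h).
{ replace (exp x - 1) with ((exp x - 1 - 1 * x) + x) by ring.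
  eapply Rle_trans; [apply Rabs_triang|]; nra. }
assert (Q2 : 0 < exp x <= 3).
{ split; [apply exp_pos|]; apply Rabs_le_between in Q1; lra. }
rewrite Cexp_0.
replace (Cexp (x, y) - RtoC 1 - RtoC 1 * (x, y))%C with
 ((exp x - 1 - 1 * x) + exp x * (cos y - 1 - 0 * y),
  exp x * (sin y - 0 - 1 * y) + (exp x - 1) * y)
 by (unfold Cexp, RtoC, Cminus, Cplus, Copp, Cmult, Re, Im; simpl; f_equal; ring).
eapply Rle_trans; [apply Cmod_le_Rabs|].
apply Rle_trans with ((e * h + 3 * (e * h)) + (3 * (e * h) + 2 * h * e)); [|nra].
apply Rplus_le_compat; (eapply Rle_trans; [apply Rabs_triang|]);
 rewrite !Rabs_mult, (Rabs_pos_eq (exp x)) by lra.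
- apply Rplus_le_compat; [exact H1'|]; apply Rmult_le_compat; try lra; apply Rabs_pos.
- apply Rplus_le_compat; apply Rmult_le_compat; try lra; apply Rabs_pos.
Qed.

Lemma cder_Cexp (z : C) : cder Cexp z (Cexp z).
Proof.
apply cder_ext_loc with (f := fun w => (Cexp z * Cexp (w - z))%C) (d0 := 1); [lra| |].
- intros w _; rewrite <- Cexp_plus; f_equal; ring.
- eapply cder_eq; [|apply cder_mult; [apply cder_const|apply (cder_comp Cexp (fun w => w - z)%C)]].
  3: apply cder_minus; [apply cder_id|apply cder_const].
  2: replace (z - z)%C with (RtoC 0) by ring; apply cder_Cexp_0.
  cbv beta; ring.
Qed.

Definition circ (t : C) : C := Cexp (Ci * t).

Lemma cder_circ (t : C) : cder circ t (Ci * circ t)%C.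
Proof.
eapply cder_eq; [|apply (cder_comp Cexp (fun t => Ci * t)%C); [apply cder_Cexp|]].
2: apply cder_mult; [apply cder_const|apply cder_id].
unfold circ; cbv beta; ring.
Qed.

Lemma ccont_circ (t : C) : ccont circ t.
Proof. exact (cder_ccont _ _ _ (cder_circ t)). Qed.

Lemma Cmod_circ (t : R) : Cmod (circ (RtoC t)) = 1.
Proof.
unfold circ, Cexp, Cmod, Ci, RtoC, Cmult, Re, Im; simpl.
replace (0 * t - 1 * 0) with 0 by ring; replace (0 * 0 + 1 * t) with t by ring.
rewrite exp_0; replace (_ + _) with 1; [apply sqrt_1|].
generalize (sin2_cos2 t); unfold Rsqr; lra.
Qed.

Lemma circ_neq_0 (t : C) : circ t <> RtoC 0.
Proof. apply Cexp_neq_0. Qed.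

Lemma circ_0 : circ (RtoC 0) = RtoC 1.
Proof. unfold circ; rewrite Cmult_0_r; apply Cexp_0. Qed.

Lemma circ_2PI : circ (RtoC (2 * PI)) = RtoC 1.
Proof.
unfold circ, Cexp, Ci, RtoC, Cmult, Re, Im; simpl.
replace (0 * (2 * PI) - 1 * 0) with 0 by ring.
replace (0 * 0 + 1 * (2 * PI)) with (2 * PI) by ring.
rewrite exp_0, cos_2PI, sin_2PI; f_equal; ring.
Qed.

Lemma ccont_const (c z : C) : ccont (fun _ => c) z.
Proof. exact (cder_ccont _ _ _ (cder_const c z)). Qed.

Lemma ccont_minus (f g : C -> C) (z : C) :
  ccont f z -> ccont g z -> ccont (fun w => f w - g w)%C z.
Proof.
intros Hf Hg eps Heps.
destruct (Hf (eps / 2)) as (d1 & Hd1 & H1); [lra|].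
destruct (Hg (eps / 2)) as (d2 & Hd2 & H2); [lra|].
exists (Rmin d1 d2); split; [apply Rmin_pos; assumption|]; intros w Bw.
specialize (H1 w (Rlt_le_trans _ _ _ Bw (Rmin_l _ _))).
specialize (H2 w (Rlt_le_trans _ _ _ Bw (Rmin_r _ _))).
rewrite Cmod_sub_sym in H2.
replace (f w - g w - (f z - g z))%C with ((f w - f z) + (g z - g w))%C by ring.
eapply Rle_lt_trans; [apply Cmod_triangle|lra].
Qed.

Lemma ccont_inv (f : C -> C) (z : C) :
  f z <> RtoC 0 -> ccont f z -> ccont (fun w => / f w)%C z.
Proof.
intros Hz Hf; apply (ccont_comp Cinv f); [|exact Hf].
exact (cder_ccont _ _ _ (cder_inv_id _ Hz)).
Qed.

Lemma ccont_div (f g : C -> C) (z : C) :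
  g z <> RtoC 0 -> ccont f z -> ccont g z -> ccont (fun w => f w / g w)%C z.
Proof.
intros Hz Hf Hg; apply (ccont_mult f (fun w => / g w)%C); [exact Hf|].
apply ccont_inv; assumption.
Qed.

Lemma Cmod_small_eq_0 (a : C) : (forall e, 0 < e -> Cmod a <= e) -> a = RtoC 0.
Proof.
intros H; apply Cmod_eq_0.
destruct (Rle_lt_or_eq_dec 0 (Cmod a)) as [L|L]; [apply Cmod_ge_0| |auto].
specialize (H (Cmod a / 2)); lra.
Qed.

(* Goursat for a homotopy of closed curves: the vertical sides [t = c0] and
   [t = d0] of the rectangle have the same image. *)
Lemma closed_homotopy (F : C -> C) (H Hs Ht : C -> C -> C) (a0 b0 c0 d0 M : R) :
  a0 <= b0 -> c0 <= d0 ->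
  (forall s t : R, a0 <= s <= b0 -> c0 <= t <= d0 ->
     cder (fun u => H u (RtoC t)) (RtoC s) (Hs (RtoC s) (RtoC t)) /\
     cder (fun u => H (RtoC s) u) (RtoC t) (Ht (RtoC s) (RtoC t)) /\
     ccont (fun u => Hs u (RtoC t)) (RtoC s) /\
     ccont (fun u => Ht (RtoC s) u) (RtoC t) /\
     Cmod (Hs (RtoC s) (RtoC t)) <= M /\ Cmod (Ht (RtoC s) (RtoC t)) <= M /\
     exists l, cder F (H (RtoC s) (RtoC t)) l) ->
  (forall s, H s (RtoC d0) = H s (RtoC c0) /\ Hs s (RtoC d0) = Hs s (RtoC c0)) ->
  CInt (fun u => F (H (RtoC b0) u) * Ht (RtoC b0) u)%C c0 d0 =
  CInt (fun u => F (H (RtoC a0) u) * Ht (RtoC a0) u)%C c0 d0.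
Proof.
intros Hab Hcd HH Hcl.
assert (G : boundary F H Hs Ht a0 b0 c0 d0 = RtoC 0).
{ apply Goursat with (M := M); try assumption; intros s t Hs' Ht';
   destruct (HH s t Hs' Ht') as (A1 & A2 & A3 & A4 & A5 & A6 & A7); auto. }
unfold boundary in G.
rewrite (CInt_ext (fun u => F (H u (RtoC d0)) * Hs u (RtoC d0))%C
  (fun u => F (H u (RtoC c0)) * Hs u (RtoC c0))%C a0 b0 Hab) in G.
- match type of G with (?x + ?y - ?x - ?z)%C = _ =>
    replace y with (z + (x + y - x - z))%C by ring end.
  rewrite G; ring.
- intros t _; destruct (Hcl (RtoC t)) as [-> ->]; reflexivity.
Qed.

(** * Contraction of circles: mean values, winding number, Cauchy's formula *)

Lemma two_PI_pos : 0 <= 2 * PI.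
Proof. generalize PI_RGT_0; lra. Qed.

Lemma Cmod_RtoC_pos (x : R) : 0 <= x -> Cmod (RtoC x) = x.
Proof. intros H; rewrite Cmod_R; apply Rabs_pos_eq, H. Qed.

Lemma Cmod_scaled_circ (r t : R) : 0 <= r -> Cmod (RtoC r * circ (RtoC t)) = r.
Proof.
intros H; rewrite Cmod_mult, Cmod_circ, Cmod_RtoC_pos by exact H; ring.
Qed.

(** The circle is contracted radially towards z. The homotopy stops at the scale sigma > 0, so it
    never meets z, where [G] may be singular. *)
Lemma star_contour (G : C -> C) (z : C) (r sigma : R) :
  Cmod z < r -> 0 < sigma <= 1 ->
  (forall w, Cmod w <= r -> w <> z -> exists l, cder G w l) ->
  CInt (fun t => G (RtoC r * circ t) * (RtoC r * (Ci * circ t)))%C 0 (2 * PI) =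
  CInt (fun t => G (z + RtoC sigma * (RtoC r * circ t - z)) *
                 (RtoC sigma * (RtoC r * (Ci * circ t))))%C 0 (2 * PI).
Proof.
intros Hz Hsig HG; assert (Hz0 := Cmod_ge_0 z).
rewrite <- (closed_homotopy G (fun s t => z + s * (RtoC r * circ t - z))%C
  (fun s t => RtoC r * circ t - z)%C (fun s t => s * (RtoC r * (Ci * circ t)))%C
  sigma 1 0 (2 * PI) (2 * r)).
- apply CInt_ext; [apply two_PI_pos|]; intros t _; f_equal; [f_equal|]; ring.
- lra.
- apply two_PI_pos.
- intros s t Hs Ht.
  assert (E := Cmod_scaled_circ r t ltac:(lra)).
  assert (Hn : (RtoC r * circ (RtoC t) - z)%C <> RtoC 0).
  { intros H; rewrite <- E in Hz; replace (RtoC r * circ (RtoC t))%C with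
     ((RtoC r * circ (RtoC t) - z) + z)%C in Hz by ring.
    rewrite H, Cplus_0_l in Hz; lra. }
  assert (Hsn : RtoC s <> RtoC 0) by (intros H; apply RtoC_inj in H; lra).
  split; [|split; [|split; [|split; [|split; [|split]]]]].
  + eapply cder_eq; [|apply cder_plus; [apply cder_const|
      apply cder_mult; [apply cder_id|apply cder_const]]]; cbv beta; ring.
  + eapply cder_eq; [|apply cder_plus; [apply cder_const|
      apply cder_mult; [apply cder_const|apply cder_minus; [apply cder_mult;
       [apply cder_const|apply cder_circ]|apply cder_const]]]]; cbv beta; ring.
  + apply ccont_const.
  + repeat (apply ccont_mult; [apply ccont_const|]); apply ccont_circ.
  + unfold Cminus; eapply Rle_trans; [apply Cmod_triangle|]; rewrite Cmod_opp; lra.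
  + rewrite !Cmod_mult, Cmod_circ, Cmod_Ci, !Cmod_RtoC_pos by lra; nra.
  + apply HG.
    * replace (z + RtoC s * (RtoC r * circ (RtoC t) - z))%C with
       (RtoC (1 - s) * z + RtoC s * (RtoC r * circ (RtoC t)))%C
       by (rewrite RtoC_minus; ring).
      eapply Rle_trans; [apply Cmod_triangle|].
      rewrite (Cmod_mult (RtoC (1 - s))), (Cmod_mult (RtoC s)), E, !Cmod_RtoC_pos by lra; nra.
    * intros H; apply (Cmult_neq_0 _ _ Hsn Hn).
      match type of H with ?a = _ => replace (RtoC s * (RtoC r * circ (RtoC t) - z))%C
        with (a - z)%C by ring end; rewrite H; ring.
- intros s; rewrite circ_0, circ_2PI; split; reflexivity.
Qed.

(** On a circle about 0, dw / w = i dt, so the mean of [F] is a contour integral of F w / w and does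
    not change when the circle shrinks. Continuity at 0 gives its limit. *)
Lemma mean_value (F : C -> C) (r : R) : 0 < r ->
  (forall w, Cmod w <= r -> w <> RtoC 0 -> exists l, cder F w l) ->
  ccont F (RtoC 0) ->
  CInt (fun t => F (RtoC r * circ t))%C 0 (2 * PI) = (RtoC (2 * PI) * F (RtoC 0))%C.
Proof.
intros Hr HF H0.
assert (Hr0 : RtoC r <> RtoC 0) by (intros H; apply RtoC_inj in H; lra).
assert (Hc : forall sigma, 0 < sigma <= 1 ->
  cont_on (fun t => F (RtoC (sigma * r) * circ t))%C 0 (2 * PI)).
{ intros sigma Hs t _; apply (ccont_comp F (fun t => RtoC (sigma * r) * circ t)%C).
  - assert (E := Cmod_scaled_circ (sigma * r) t ltac:(nra)).
    destruct (HF (RtoC (sigma * r) * circ (RtoC t))%C) as [l Hl].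
    + rewrite E; nra.
    + apply Cmod_pos_nz; rewrite E; nra.
    + exact (cder_ccont _ _ _ Hl).
  - apply ccont_mult; [apply ccont_const|apply ccont_circ]. }
assert (HS : forall sigma, 0 < sigma <= 1 ->
  CInt (fun t => F (RtoC r * circ t))%C 0 (2 * PI) =
  CInt (fun t => F (RtoC (sigma * r) * circ t))%C 0 (2 * PI)).
{ intros sigma Hs.
  assert (S := star_contour (fun w => F w / w)%C (RtoC 0) r sigma
    ltac:(rewrite Cmod_0; exact Hr) Hs).
  assert (Hs0 : RtoC sigma <> RtoC 0) by (intros H; apply RtoC_inj in H; lra).
  assert (C1 := Hc 1 ltac:(lra)); rewrite Rmult_1_l in C1.
  (* The factor 1 = -i i supplies the i of dw / w = i dt. *)
  replace (CInt (fun t => F (RtoC r * circ t))%C 0 (2 * PI)) with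
   (- Ci * (Ci * CInt (fun t => F (RtoC r * circ t))%C 0 (2 * PI)))%C.
  2:{ rewrite Cmult_assoc; replace (- Ci * Ci)%C with (RtoC 1); [ring|].
      unfold Ci, RtoC, Cmult, Copp; simpl; f_equal; ring. }
  replace (CInt (fun t => F (RtoC (sigma * r) * circ t))%C 0 (2 * PI)) with
   (- Ci * (Ci * CInt (fun t => F (RtoC (sigma * r) * circ t))%C 0 (2 * PI)))%C.
  2:{ rewrite Cmult_assoc; replace (- Ci * Ci)%C with (RtoC 1); [ring|].
      unfold Ci, RtoC, Cmult, Copp; simpl; f_equal; ring. }
  f_equal.
  rewrite <- !CInt_scal by (try apply two_PI_pos; try exact C1; apply Hc; exact Hs).
  etransitivity; [etransitivity; [|apply S]|].
  - apply CInt_ext; [apply two_PI_pos|]; intros t _; field.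
    split; [apply circ_neq_0|exact Hr0].
  - intros w Hw Hw0; destruct (HF w Hw Hw0) as [l Hl].
    eexists; apply cder_div; [exact Hw0|exact Hl|apply cder_id].
  - apply CInt_ext; [apply two_PI_pos|]; intros t _.
    replace (RtoC 0 + RtoC sigma * (RtoC r * circ (RtoC t) - RtoC 0))%C
      with (RtoC (sigma * r) * circ (RtoC t))%C by (rewrite RtoC_mult; ring).
    rewrite RtoC_mult; field.
    repeat split; first [exact Hr0|exact Hs0|apply circ_neq_0]. }
set (I := CInt (fun t => F (RtoC r * circ t))%C 0 (2 * PI)) in *.
replace I with (RtoC (2 * PI) * F (RtoC 0) + (I - RtoC (2 * PI) * F (RtoC 0)))%C by ring.
rewrite (Cmod_small_eq_0 (I - RtoC (2 * PI) * F (RtoC 0))%C); [ring|].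
intros e He.
assert (HPI := PI_RGT_0).
destruct (H0 (e / (2 * PI))) as (d & Hd & Hw); [apply Rdiv_lt_0_compat; lra|].
(* The circle of radius sigma r lies where [F] is within e / (2 pi) of its value at 0. *)
set (sigma := Rmin 1 (d / (2 * r))).
assert (Hsig : 0 < sigma <= 1).
{ split; [apply Rmin_pos; [lra|apply Rdiv_lt_0_compat; lra]|apply Rmin_l]. }
assert (Hsr : sigma * r < d).
{ apply Rle_lt_trans with (d / (2 * r) * r).
  - apply Rmult_le_compat_r; [lra|apply Rmin_r].
  - replace (d / (2 * r) * r) with (d / 2) by (field; lra); lra. }
rewrite (HS sigma Hsig).
assert (EC := CInt_const (F (RtoC 0)) 0 (2 * PI)).
rewrite Rminus_0_r in EC; rewrite <- EC.
rewrite <- CInt_minus; [|apply two_PI_pos|apply Hc, Hsig|intros t _; apply ccont_const].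
replace e with ((2 * PI - 0) * (e / (2 * PI))) by (field; lra).
apply CInt_bound; [apply two_PI_pos| |].
- intros t Ht; apply ccont_minus; [apply (Hc sigma Hsig t Ht)|apply ccont_const].
- intros t _; left; apply Hw.
  replace (RtoC (sigma * r) * circ (RtoC t) - RtoC 0)%C
    with (RtoC (sigma * r) * circ (RtoC t))%C by ring.
  rewrite Cmod_scaled_circ; [exact Hsr|nra].
Qed.

Lemma circle_minus_neq_0 (z : C) (r t : R) :
  Cmod z < r -> (RtoC r * circ (RtoC t) - z)%C <> RtoC 0.
Proof.
intros Hz H; assert (Hz0 := Cmod_ge_0 z).
assert (E := Cmod_scaled_circ r t ltac:(lra)).
rewrite <- E in Hz; replace (RtoC r * circ (RtoC t))%C with
  ((RtoC r * circ (RtoC t) - z) + z)%C in Hz by ring.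
rewrite H, Cplus_0_l in Hz; lra.
Qed.

(** Here the circle is translated rather than contracted: the curves r e^(it) - s z avoid 0 for s
    from 0 to 1, and at s = 0 the integrand of dw / w is the constant i. *)
Lemma winding_number (z : C) (r : R) : Cmod z < r ->
  CInt (fun t => / (RtoC r * circ t - z) * (RtoC r * (Ci * circ t)))%C 0 (2 * PI)
  = (RtoC (2 * PI) * Ci)%C.
Proof.
intros Hz; assert (Hz0 := Cmod_ge_0 z).
assert (Hr0 : RtoC r <> RtoC 0) by (intros H; apply RtoC_inj in H; lra).
assert (S := closed_homotopy Cinv (fun s t => RtoC r * circ t - s * z)%C
  (fun s t => - z)%C (fun s t => RtoC r * (Ci * circ t))%C 0 1 0 (2 * PI) r).
cbv beta in S.
etransitivity; [etransitivity; [|apply S]|].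
- apply CInt_ext; [apply two_PI_pos|]; intros t _; do 3 f_equal; ring.
- lra.
- apply two_PI_pos.
- intros s t Hs _.
  split; [|split; [|split; [|split; [|split; [|split]]]]].
  + eapply cder_eq; [|apply cder_minus; [apply cder_const|
      apply cder_mult; [apply cder_id|apply cder_const]]]; cbv beta; ring.
  + eapply cder_eq; [|apply cder_minus; [apply cder_mult; [apply cder_const|
      apply cder_circ]|apply cder_const]]; cbv beta; ring.
  + apply ccont_const.
  + repeat (apply ccont_mult; [apply ccont_const|]); apply ccont_circ.
  + rewrite Cmod_opp; lra.
  + rewrite !Cmod_mult, Cmod_circ, Cmod_Ci, !Cmod_RtoC_pos by lra; lra.
  + eexists; apply cder_inv_id, circle_minus_neq_0.
    rewrite Cmod_mult, Cmod_RtoC_pos by lra; nra.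
- intros s; rewrite circ_0, circ_2PI; split; reflexivity.
- etransitivity; [|etransitivity; [exact (CInt_const Ci 0 (2 * PI))|]].
  + apply CInt_ext; [apply two_PI_pos|]; intros t _; field.
    repeat split; first [exact Hr0|apply circ_neq_0].
  + rewrite Rminus_0_r; reflexivity.
Qed.

Lemma Ci_sqr : (- Ci * Ci)%C = RtoC 1.
Proof. unfold Ci, RtoC, Cmult, Copp; simpl; f_equal; ring. Qed.

Lemma circ_cont_on (f : C -> C) (r a b : R) :
  (forall t : R, exists l, cder f (RtoC r * circ (RtoC t))%C l) ->
  cont_on (fun t => f (RtoC r * circ t))%C a b.
Proof.
intros H t _; apply (ccont_comp f (fun t => RtoC r * circ t)%C).
- destruct (H t) as [l Hl]; exact (cder_ccont _ _ _ Hl).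
- apply ccont_mult; [apply ccont_const|apply ccont_circ].
Qed.

(** The difference quotient [G] is bounded near z, so its integral over a contour shrunk by sigma is
    O(sigma), and therefore it vanishes. The winding number accounts for the constant f z. As dw = i
    e dt on the circle, the formula is written with e / (e - z) dt in place of dw / (i (w - z)). *)
Lemma Cauchy_formula (f : C -> C) (r : R) :
  (forall w, Cmod w <= r -> exists l, cder f w l) ->
  forall z, Cmod z < r ->
  CInt (fun t => f (RtoC r * circ t) * (RtoC r * circ t) / (RtoC r * circ t - z))%C
    0 (2 * PI) = (RtoC (2 * PI) * f z)%C.
Proof.
intros Hf z Hz; assert (Hz0 := Cmod_ge_0 z); assert (HPI := PI_RGT_0).
set (G := fun w => ((f w - f z) / (w - z))%C).
set (e := fun t => (RtoC r * circ t)%C).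
assert (Hce : forall t, ccont e t).
{ intros t; apply ccont_mult; [apply ccont_const|apply ccont_circ]. }
assert (Hfc : cont_on (fun t => f (e t)) 0 (2 * PI)).
{ apply circ_cont_on; intros t; apply Hf; rewrite Cmod_scaled_circ; lra. }
assert (Hnz : forall t : R, (e (RtoC t) - z)%C <> RtoC 0).
{ intros t; apply circle_minus_neq_0, Hz. }
assert (HG : forall w, Cmod w <= r -> w <> z -> exists l, cder G w l).
{ intros w Hw Hwz; destruct (Hf w Hw) as [l Hl].
  eexists; apply cder_div.
  - intros H; apply Hwz; replace w with ((w - z) + z)%C by ring; rewrite H; ring.
  - apply cder_minus; [exact Hl|apply cder_const].
  - apply cder_minus; [apply cder_id|apply cder_const]. }
destruct (Hf z (Rlt_le _ _ Hz)) as [l Hl].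
destruct (cder_lip f z l Hl) as (d & Hd & Hlip).
assert (HI : CInt (fun t => G (e t) * (RtoC r * (Ci * circ t)))%C 0 (2 * PI) = RtoC 0).
{ apply Cmod_small_eq_0; intros eps Heps.
  set (K := Cmod l + 1) in *.
  assert (HK : 0 < K) by (unfold K; generalize (Cmod_ge_0 l); lra).
  (* The integral is at most sigma k / 2. The bound d / (2 r) on sigma keeps the shrunk contour
     within d of z, since |e - z| < 2 r. *)
  set (k := 2 * PI * (K * (2 * r))).
  assert (Hk : 0 < k) by (assert (0 < K * (2 * r)) by nra; unfold k; nra).
  assert (Hm1 : 0 < d / (2 * r)).
  { apply Rdiv_lt_0_compat; lra. }
  assert (Hm2 : 0 < eps / k) by (apply Rdiv_lt_0_compat; lra).
  set (sigma := Rmin 1 (Rmin (d / (2 * r)) (eps / k))).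
  assert (Hsig : 0 < sigma <= 1).
  { split; [apply Rmin_pos; [lra|apply Rmin_pos; assumption]|apply Rmin_l]. }
  assert (Hs1 : sigma <= d / (2 * r)) by (eapply Rle_trans; [apply Rmin_r|apply Rmin_l]).
  assert (Hs2 : sigma <= eps / k) by (eapply Rle_trans; [apply Rmin_r|apply Rmin_r]).
  assert (Hsn : RtoC sigma <> RtoC 0) by (intros H; apply RtoC_inj in H; lra).
  unfold e; rewrite (star_contour G z r sigma Hz Hsig HG).
  apply Rle_trans with ((2 * PI - 0) * (K * (sigma * r))).
  - apply CInt_bound; [lra| |].
    + intros t Ht.
      apply (ccont_mult (fun t => G (z + RtoC sigma * (RtoC r * circ t - z))%C)).
      * apply (ccont_comp G (fun t => z + RtoC sigma * (RtoC r * circ t - z))%C).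
        -- destruct (HG (z + RtoC sigma * (RtoC r * circ (RtoC t) - z))%C) as [m Hm].
           ++ replace (z + RtoC sigma * (RtoC r * circ (RtoC t) - z))%C with
               (RtoC (1 - sigma) * z + RtoC sigma * (RtoC r * circ (RtoC t)))%C
               by (rewrite RtoC_minus; ring).
              eapply Rle_trans; [apply Cmod_triangle|].
              rewrite (Cmod_mult (RtoC (1 - sigma))), (Cmod_mult (RtoC sigma)),
               Cmod_scaled_circ, !Cmod_RtoC_pos by lra; nra.
           ++ intros H; apply (Cmult_neq_0 _ _ Hsn (Hnz t)); unfold e.
              match type of H with ?a = _ =>
               replace (RtoC sigma * (RtoC r * circ (RtoC t) - z))%C
               with (a - z)%C by ring end; rewrite H; ring.
           ++ exact (cder_ccont _ _ _ Hm).
        -- eapply cder_ccont; apply cder_plus; [apply cder_const|apply cder_mult; [apply cder_const|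
            apply cder_minus; [apply cder_mult; [apply cder_const|apply cder_circ]|apply cder_const]]].
      * repeat (apply ccont_mult; [apply ccont_const|]); apply ccont_circ.
    + intros t _.
      assert (B : Cmod (e (RtoC t) - z) < 2 * r).
      { unfold Cminus; eapply Rle_lt_trans; [apply Cmod_triangle|].
        unfold e; rewrite Cmod_opp, Cmod_scaled_circ; lra. }
      rewrite Cmod_mult; apply Rmult_le_compat; try apply Cmod_ge_0.
      * fold (e (RtoC t)); set (h := (RtoC sigma * (e (RtoC t) - z))%C).
        assert (Hh0 : h <> RtoC 0) by (apply Cmult_neq_0; [exact Hsn|apply Hnz]).
        assert (Hh : Cmod h < d).
        { unfold h; rewrite Cmod_mult, Cmod_RtoC_pos by lra.
          apply Rlt_le_trans with (sigma * (2 * r)); [nra|].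
          apply Rle_trans with (d / (2 * r) * (2 * r)); [nra|right; field; lra]. }
        unfold G; replace (z + h - z)%C with h by ring.
        rewrite Cmod_div by exact Hh0.
        apply Rmult_le_reg_r with (Cmod h); [apply Cmod_gt_0, Hh0|].
        unfold Rdiv; rewrite Rmult_assoc, Rinv_l, Rmult_1_r
         by (apply Rgt_not_eq, Cmod_gt_0, Hh0).
        specialize (Hlip (z + h)%C); replace (z + h - z)%C with h in Hlip by ring.
        apply Hlip, Hh.
      * rewrite !Cmod_mult, Cmod_circ, Cmod_Ci, !Cmod_RtoC_pos by lra; lra.
  - apply Rle_trans with (eps / k * k / 2); [|replace (eps / k * k) with eps by (field; lra); lra].
    replace ((2 * PI - 0) * (K * (sigma * r))) with (sigma * k / 2) by (unfold k; field).
    nra. }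
assert (HW := winding_number z r Hz).
change (RtoC r * circ ?t)%C with (e t) in HW.
set (J := CInt (fun t => f (e t) * e t / (e t - z))%C 0 (2 * PI)).
change (J = (RtoC (2 * PI) * f z)%C).
assert (Hic : cont_on (fun t => / (e t - z) * (RtoC r * (Ci * circ t)))%C 0 (2 * PI)).
{ intros t _; apply ccont_mult.
  - apply ccont_inv; [apply Hnz|apply ccont_minus; [apply Hce|apply ccont_const]].
  - repeat (apply ccont_mult; [apply ccont_const|]); apply ccont_circ. }
assert (HJc : cont_on (fun t => f (e t) * e t / (e t - z))%C 0 (2 * PI)).
{ intros t Ht; apply ccont_div; [apply Hnz| |apply ccont_minus; [apply Hce|apply ccont_const]].
  apply ccont_mult; [apply Hfc, Ht|apply Hce]. }
(* The integrand of [HI] is i times that of [J] minus f z times that of the winding number. *)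
assert (HJ : (Ci * J - f z * (RtoC (2 * PI) * Ci))%C = RtoC 0).
{ rewrite <- HI, <- HW; unfold J.
  rewrite <- !CInt_scal by (try exact Hic; try exact HJc; lra).
  rewrite <- CInt_minus.
  - apply CInt_ext; [lra|]; intros t _; unfold G.
    replace (RtoC r * (Ci * circ (RtoC t)))%C with (Ci * e (RtoC t))%C by (unfold e; ring).
    field; apply Hnz.
  - lra.
  - intros t Ht; apply ccont_mult; [apply ccont_const|apply (HJc t Ht)].
  - intros t Ht; apply ccont_mult; [apply ccont_const|apply (Hic t Ht)]. }
replace J with (- Ci * Ci * J)%C by (rewrite Ci_sqr; ring).
replace (- Ci * Ci * J)%C with
  (- Ci * (Ci * J - f z * (RtoC (2 * PI) * Ci)) + (- Ci * Ci) * (RtoC (2 * PI) * f z))%C by ring.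
rewrite HJ, Ci_sqr; ring.
Qed.

(** * Cauchy integrals *)

(** Differentiation under the integral sign from a quadratic remainder that is uniform in t, which
    the Cauchy kernels provide by explicit algebra. *)
Lemma cder_CInt (k : C -> C -> C) (k1 : C -> C) (z : C) (a b d B : R) :
  a <= b -> 0 < d -> 0 <= B ->
  (forall w, Cmod (w - z) < d -> cont_on (k w) a b) -> cont_on k1 a b ->
  (forall w (t : R), Cmod (w - z) < d -> a <= t <= b ->
     Cmod (k w (RtoC t) - k z (RtoC t) - (w - z) * k1 (RtoC t))
     <= B * (Cmod (w - z) * Cmod (w - z))) ->
  cder (fun w => CInt (k w) a b) z (CInt k1 a b).
Proof.
intros Hab Hd HB Hk Hk1 HE eps Heps.
assert (Hz : Cmod (z - z) < d).
{ replace (z - z)%C with (RtoC 0) by ring; rewrite Cmod_0; exact Hd. }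
set (c := (b - a) * B + 1).
assert (Hc : 0 < c) by (unfold c; nra).
assert (Hec : 0 < eps / c) by (apply Rdiv_lt_0_compat; lra).
exists (Rmin d (eps / c)); split; [apply Rmin_pos; assumption|]; intros w Bw.
assert (B1 := Rlt_le_trans _ _ _ Bw (Rmin_l _ _)).
assert (B2 := Rlt_le_trans _ _ _ Bw (Rmin_r _ _)).
assert (H1 : cont_on (fun t => k w t - k z t)%C a b).
{ intros t Ht; apply ccont_minus; [apply (Hk w B1 t Ht)|apply (Hk z Hz t Ht)]. }
assert (H2 : cont_on (fun t => (w - z) * k1 t)%C a b).
{ intros t Ht; apply ccont_mult; [apply ccont_const|apply (Hk1 t Ht)]. }
rewrite (Cmult_comm (CInt k1 a b)), <- CInt_scal by assumption.
rewrite <- CInt_minus by (try assumption; try exact (Hk w B1); exact (Hk z Hz)).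
rewrite <- CInt_minus by assumption.
set (h := Cmod (w - z)) in *.
assert (Hh : 0 <= h) by apply Cmod_ge_0.
apply Rle_trans with ((b - a) * (B * (h * h))).
- apply CInt_bound; [exact Hab| |].
  + intros t Ht; apply ccont_minus; [apply (H1 t Ht)|apply (H2 t Ht)].
  + intros t Ht; apply HE; assumption.
- replace ((b - a) * (B * (h * h))) with ((c - 1) * h * h) by (unfold c; ring).
  assert (c * h <= eps).
  { apply Rmult_lt_compat_l with (r := c) in B2; [|exact Hc].
    replace (c * (eps / c)) with eps in B2 by (field; lra); lra. }
  nra.
Qed.

Lemma cont_on_bounded (g : C -> C) (a b : R) : cont_on g a b ->
  exists B, 0 <= B /\ forall t : R, a <= t <= b -> Cmod (g (RtoC t)) <= B.
Proof.
intros Hg.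
destruct (@bounded_continuity R_AbsRing C_R_NormedModule (fun t => g (RtoC t)) a b)
  as [B HB].
- intros t Ht; apply (ccont_continuous_real g), Hg, Ht.
- exists (Rmax B 0); split; [apply Rmax_r|]; intros t Ht.
  apply Rle_trans with (2 := Rmax_l _ _); left; rewrite <- norm_R_Cmod; apply HB, Ht.
Qed.

Section CauchyKernel.

Variables (g : C -> C) (r : R).
Hypothesis Hg : cont_on g 0 (2 * PI).

(** The Cauchy kernel of order n; any factor coming from dw is absorbed into [g]. *)
Definition Ck (n : nat) (z t : C) : C := (g t / (RtoC r * circ t - z) ^ n)%C.

Lemma Ck_cont (n : nat) (z : C) : Cmod z < r -> cont_on (Ck n z) 0 (2 * PI).
Proof.
intros Hz t Ht; unfold Ck; apply ccont_div.
- apply Cpow_nz, circle_minus_neq_0, Hz.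
- apply Hg, Ht.
- induction n; simpl; [apply ccont_const|].
  apply (ccont_mult (fun w => RtoC r * circ w - z)%C); [|exact IHn].
  apply ccont_minus; [|apply ccont_const].
  apply ccont_mult; [apply ccont_const|apply ccont_circ].
Qed.

Lemma circle_dist (z : C) (t : R) : 0 <= r ->
  r - Cmod z <= Cmod (RtoC r * circ (RtoC t) - z) <= r + Cmod z.
Proof.
intros Hr; assert (E := Cmod_scaled_circ r t Hr); split.
- generalize (Cmod_le_sub (RtoC r * circ (RtoC t)) z); lra.
- unfold Cminus; generalize (Cmod_triangle (RtoC r * circ (RtoC t)) (- z)).
  rewrite Cmod_opp; lra.
Qed.

Lemma cder_Ck_1 (z : C) : Cmod z < r ->
  cder (fun w => CInt (Ck 1 w) 0 (2 * PI)) z (CInt (Ck 2 z) 0 (2 * PI)).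
Proof.
intros Hz; assert (Hz0 := Cmod_ge_0 z).
destruct (cont_on_bounded g _ _ Hg) as (B & HB0 & HB).
(* For |w - z| < d both z and w keep at least the distance d from the circle, which bounds the
   denominators from below. *)
set (d := (r - Cmod z) / 2).
assert (Hd : 0 < d) by (unfold d; lra).
assert (Hdr : r - Cmod z = 2 * d) by (unfold d; lra).
clearbody d.
assert (Hwr : forall w, Cmod (w - z) < d -> Cmod w < r - d).
{ intros w Hw; generalize (Cmod_le_sub w z); lra. }
apply cder_CInt with (d := d) (B := B / (d * d * d)).
- apply two_PI_pos.
- exact Hd.
- apply Rmult_le_pos; [exact HB0|left; apply Rinv_0_lt_compat; repeat apply Rmult_lt_0_compat; exact Hd].
- intros w Hw; apply Ck_cont; specialize (Hwr w Hw); lra.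
- apply Ck_cont, Hz.
- intros w t Hw Ht; specialize (Hwr w Hw).
  assert (N1 := circle_minus_neq_0 z r t Hz).
  assert (N2 := circle_minus_neq_0 w r t ltac:(lra)).
  assert (D1 := circle_dist z t ltac:(lra)).
  assert (D2 := circle_dist w t ltac:(lra)).
  set (e := (RtoC r * circ (RtoC t))%C) in *.
  (* The exact remainder of the first-order expansion of g / (e - w) at z. *)
  replace (Ck 1 w (RtoC t) - Ck 1 z (RtoC t) - (w - z) * Ck 2 z (RtoC t))%C
   with (g (RtoC t) / ((e - z) * (e - z) * (e - w)) * ((w - z) * (w - z)))%C.
  2:{ unfold Ck; fold e; simpl; field; split; assumption. }
  rewrite !Cmod_mult, Cmod_div, !Cmod_mult by (repeat apply Cmult_neq_0; assumption).
  apply Rmult_le_compat_r; [apply Rmult_le_pos; apply Cmod_ge_0|].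
  apply Rmult_le_compat; [apply Cmod_ge_0| |apply HB, Ht|].
  + left; apply Rinv_0_lt_compat; repeat apply Rmult_lt_0_compat; lra.
  + apply Rinv_le_contravar; [repeat apply Rmult_lt_0_compat; exact Hd|].
    repeat apply Rmult_le_compat; try lra; try (apply Rmult_le_pos; lra); lra.
Qed.

Lemma cder_Ck_2 (z : C) : Cmod z < r ->
  cder (fun w => CInt (Ck 2 w) 0 (2 * PI)) z
    (CInt (fun t => Ck 3 z t + Ck 3 z t)%C 0 (2 * PI)).
Proof.
intros Hz; assert (Hz0 := Cmod_ge_0 z).
destruct (cont_on_bounded g _ _ Hg) as (B & HB0 & HB).
set (d := (r - Cmod z) / 2).
assert (Hd : 0 < d) by (unfold d; lra).
assert (Hdr : r - Cmod z = 2 * d) by (unfold d; lra).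
clearbody d.
assert (Hd3 : 0 < d * d * d) by (repeat apply Rmult_lt_0_compat; exact Hd).
assert (Hd5 : 0 < d * d * d * (d * d)) by (repeat apply Rmult_lt_0_compat; exact Hd).
assert (Hwr : forall w, Cmod (w - z) < d -> Cmod w < r - d).
{ intros w Hw; generalize (Cmod_le_sub w z); lra. }
(* The factor 8 r is a generous bound for |e - z| + 2 |e - w|, each distance being below 2 r. *)
apply cder_CInt with (d := d) (B := B / (d * d * d * (d * d)) * (8 * r)).
- apply two_PI_pos.
- exact Hd.
- apply Rmult_le_pos; [|lra].
  apply Rmult_le_pos; [exact HB0|left; apply Rinv_0_lt_compat; exact Hd5].
- intros w Hw; apply Ck_cont; specialize (Hwr w Hw); lra.
- intros t Ht eps Heps.
  destruct (Ck_cont 3 z Hz t Ht (eps / 2)) as (d' & Hd' & H); [lra|].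
  exists d'; split; [exact Hd'|]; intros w Hw; specialize (H w Hw).
  replace (Ck 3 z w + Ck 3 z w - (Ck 3 z (RtoC t) + Ck 3 z (RtoC t)))%C
   with ((Ck 3 z w - Ck 3 z (RtoC t)) + (Ck 3 z w - Ck 3 z (RtoC t)))%C by ring.
  eapply Rle_lt_trans; [apply Cmod_triangle|lra].
- intros w t Hw Ht; specialize (Hwr w Hw).
  assert (N1 := circle_minus_neq_0 z r t Hz).
  assert (N2 := circle_minus_neq_0 w r t ltac:(lra)).
  assert (D1 := circle_dist z t ltac:(lra)).
  assert (D2 := circle_dist w t ltac:(lra)).
  set (e := (RtoC r * circ (RtoC t))%C) in *.
  replace (Ck 2 w (RtoC t) - Ck 2 z (RtoC t) - (w - z) * (Ck 3 z (RtoC t) + Ck 3 z (RtoC t)))%C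
   with (g (RtoC t) / ((e - z) * (e - z) * (e - z) * ((e - w) * (e - w)))
     * ((e - z) + (e - w) + (e - w)) * ((w - z) * (w - z)))%C.
  2:{ unfold Ck; fold e; simpl; field; split; assumption. }
  rewrite !Cmod_mult, Cmod_div, !Cmod_mult by (repeat apply Cmult_neq_0; assumption).
  apply Rmult_le_compat_r; [apply Rmult_le_pos; apply Cmod_ge_0|].
  assert (P1 : 0 < Cmod (e - z)) by lra.
  assert (P2 : 0 < Cmod (e - w)) by lra.
  assert (P1d : d <= Cmod (e - z)) by (lra).
  assert (P2d : d <= Cmod (e - w)) by lra.
  apply Rmult_le_compat; [|apply Cmod_ge_0| |].
  + apply Rmult_le_pos; [apply Cmod_ge_0|].
    left; apply Rinv_0_lt_compat; repeat apply Rmult_lt_0_compat; assumption.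
  + apply Rmult_le_compat; [apply Cmod_ge_0| |apply HB, Ht|].
    * left; apply Rinv_0_lt_compat; repeat apply Rmult_lt_0_compat; assumption.
    * apply Rinv_le_contravar; [exact Hd5|].
      apply Rmult_le_compat; [lra|nra| |nra].
      apply Rmult_le_compat; [nra|lra|nra|lra].
  + eapply Rle_trans; [apply Cmod_triangle|].
    eapply Rle_trans; [apply Rplus_le_compat_r, Cmod_triangle|]; lra.
Qed.

End CauchyKernel.

(** * Analyticity of derivatives and of f z / z *)

Lemma RtoC_neq_0 (x : R) : x <> 0 -> RtoC x <> RtoC 0.
Proof. intros Hx H; apply Hx, RtoC_inj, H. Qed.

Lemma two_PI_neq_0 : RtoC (2 * PI) <> RtoC 0.
Proof. apply RtoC_neq_0; generalize PI_RGT_0; lra. Qed.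

Lemma Cauchy_formula_Ck (f : C -> C) (r : R) : analyticD f -> r < 1 ->
  forall z, Cmod z < r ->
  f z = (/ RtoC (2 * PI) *
    CInt (Ck (fun t => f (RtoC r * circ t) * (RtoC r * circ t)) r 1 z) 0 (2 * PI))%C.
Proof.
intros Hf Hr z Hz; assert (Hz0 := Cmod_ge_0 z).
assert (A : forall w, Cmod w <= r -> exists l, cder f w l).
{ intros w Hw; eexists; apply analytic_cder; [exact Hf|unfold inD; lra]. }
rewrite (CInt_ext _ (fun t => f (RtoC r * circ t) * (RtoC r * circ t) /
   (RtoC r * circ t - z))%C 0 (2 * PI) two_PI_pos).
- rewrite (Cauchy_formula f r A z Hz); field; apply two_PI_neq_0.
- intros t _; unfold Ck; simpl; rewrite Cmult_1_r; reflexivity.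
Qed.

Lemma circle_cont (f : C -> C) (r : R) : analyticD f -> 0 <= r < 1 ->
  cont_on (fun t => f (RtoC r * circ t))%C 0 (2 * PI).
Proof.
intros Hf Hr; apply circ_cont_on; intros t; eexists; apply analytic_cder; [exact Hf|].
unfold inD; rewrite Cmod_scaled_circ; lra.
Qed.

Lemma Cauchy_derivative (f : C -> C) (r : R) : analyticD f -> r < 1 ->
  forall z, Cmod z < r ->
  C_derive f z = (/ RtoC (2 * PI) *
    CInt (Ck (fun t => f (RtoC r * circ t) * (RtoC r * circ t)) r 2 z) 0 (2 * PI))%C.
Proof.
intros Hf Hr z Hz; assert (Hz0 := Cmod_ge_0 z).
apply cder_C_derive.
apply cder_ext_loc with (d0 := r - Cmod z) (f := fun z => (/ RtoC (2 * PI) *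
    CInt (Ck (fun t => f (RtoC r * circ t) * (RtoC r * circ t)) r 1 z) 0 (2 * PI))%C); [lra| |].
- intros w Hw; rewrite <- Cauchy_formula_Ck; auto.
  generalize (Cmod_le_sub w z); lra.
- eapply cder_eq; [|apply cder_mult; [apply cder_const|apply cder_Ck_1; [|exact Hz]]].
  + cbv beta; ring.
  + intros t Ht; apply ccont_mult; [apply (circle_cont f r Hf ltac:(lra) t Ht)|].
    apply ccont_mult; [apply ccont_const|apply ccont_circ].
Qed.

(** Locally the derivative is a Cauchy integral of order 2, which can be differentiated once more.
    The factor w' in the terms z w' L(w) relies on this. *)
Lemma analytic_derivative (f : C -> C) : analyticD f -> analyticD (C_derive f).
Proof.
intros Hf z Hz; unfold inD in Hz; assert (Hz0 := Cmod_ge_0 z).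
set (r := (1 + Cmod z) / 2).
assert (Hr : Cmod z < r < 1) by (unfold r; lra).
eexists; apply is_derive_cder.
apply cder_ext_loc with (d0 := r - Cmod z) (f := fun z => (/ RtoC (2 * PI) *
    CInt (Ck (fun t => f (RtoC r * circ t) * (RtoC r * circ t)) r 2 z) 0 (2 * PI))%C); [lra| |].
- intros w Hw; rewrite <- Cauchy_derivative; auto; try lra.
  generalize (Cmod_le_sub w z); lra.
- apply cder_mult; [apply cder_const|apply cder_Ck_2; [|lra]].
  intros t Ht; apply ccont_mult; [apply (circle_cont f r Hf ltac:(lra) t Ht)|].
  apply ccont_mult; [apply ccont_const|apply ccont_circ].
Qed.

Definition slope0 (f : C -> C) (z : C) : C :=
  if Ceq_dec z (RtoC 0) then C_derive f (RtoC 0) else (f z / z)%C.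

Lemma slope0_spec (f : C -> C) (z : C) :
  f (RtoC 0) = RtoC 0 -> f z = (z * slope0 f z)%C.
Proof.
intros H0; unfold slope0; destruct (Ceq_dec z (RtoC 0)) as [->|Hz].
- rewrite H0; ring.
- field; exact Hz.
Qed.

(** Subtracting f 0 = 0 in Cauchy's formula and using e / (e - w) - 1 = w / (e - w) turns f w / w
    into the Cauchy integral of f e / (e - w) dt. At w = 0 the same integral is the derivative, so
    near 0 it represents [slope0 f] without exception. *)
Lemma analytic_slope0 (f : C -> C) :
  analyticD f -> f (RtoC 0) = RtoC 0 -> analyticD (slope0 f).
Proof.
intros Hf H0 z Hz.
destruct (Ceq_dec z (RtoC 0)) as [->|Hn]; eexists; apply is_derive_cder.
- set (r := / 2); set (g := fun t => f (RtoC r * circ t)%C).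
  assert (Hr : 0 < r < 1) by (unfold r; lra).
  assert (Hrn : RtoC r <> RtoC 0) by (apply RtoC_neq_0; lra).
  assert (Hgc : cont_on g 0 (2 * PI)) by (apply circle_cont; [exact Hf|lra]).
  assert (He : forall t, ccont (fun t => RtoC r * circ t)%C t).
  { intros t; apply ccont_mult; [apply ccont_const|apply ccont_circ]. }
  assert (Hgc' : cont_on (fun t => g t * (RtoC r * circ t))%C 0 (2 * PI)).
  { intros t Ht; apply ccont_mult; [apply Hgc, Ht|apply He]. }
  apply cder_ext_loc with (d0 := r) (f := fun z => (/ RtoC (2 * PI) *
    CInt (Ck g r 1 z) 0 (2 * PI))%C); [lra| |].
  + intros w Hw; replace (w - RtoC 0)%C with w in Hw by ring.
    unfold slope0; destruct (Ceq_dec w (RtoC 0)) as [->|Hwn].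
    * rewrite (Cauchy_derivative f r Hf ltac:(lra)) by exact Hw; f_equal.
      apply CInt_ext; [apply two_PI_pos|]; intros t _; unfold Ck, g; simpl; field.
      split; [apply circ_neq_0|exact Hrn].
    * assert (F0 := Cauchy_formula_Ck f r Hf ltac:(lra) (RtoC 0) ltac:(rewrite Cmod_0; lra)).
      rewrite H0 in F0.
      replace (f w) with (f w - RtoC 0)%C by ring; rewrite F0 at 1.
      rewrite (Cauchy_formula_Ck f r Hf ltac:(lra) w Hw) at 1.
      match goal with |- _ = ((?c * ?x - ?c * ?y) / w)%C =>
        replace ((c * x - c * y) / w)%C with (c * (/ w * (x - y)))%C
          by (field; split; [apply two_PI_neq_0|exact Hwn]) end.
      f_equal.
      assert (C1 := Ck_cont _ r Hgc' 1 w Hw).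
      assert (C2 := Ck_cont _ r Hgc' 1 (RtoC 0) ltac:(rewrite Cmod_0; lra)).
      rewrite <- CInt_minus, <- CInt_scal; try apply two_PI_pos; try assumption.
      -- apply CInt_ext; [apply two_PI_pos|]; intros t _; unfold Ck; fold (g (RtoC t)); simpl.
         assert (N := circle_minus_neq_0 w r t Hw).
         field; repeat split; first [assumption|apply circ_neq_0].
      -- intros t Ht; apply ccont_minus; [apply (C1 t Ht)|apply (C2 t Ht)].
  + apply cder_mult; [apply cder_const|apply cder_Ck_1; [exact Hgc|rewrite Cmod_0; lra]].
- apply cder_ext_loc with (d0 := Cmod z) (f := fun w => (f w / w)%C).
  + apply Cmod_gt_0, Hn.
  + intros w Hw; unfold slope0; destruct (Ceq_dec w (RtoC 0)) as [->|]; [|reflexivity].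
    exfalso; rewrite Cmod_sub_sym in Hw; replace (z - RtoC 0)%C with z in Hw by ring; lra.
  + apply cder_div; [exact Hn|apply analytic_cder; [exact Hf|exact Hz]|apply cder_id].
Qed.

(** * The Schwarz-Pick and Dieudonne inequalities *)

Lemma Cmod_sqr (z : C) : Cmod z * Cmod z = Re z * Re z + Im z * Im z.
Proof. generalize (Cmod2_alt z); simpl; lra. Qed.

(** The maximum principle at the centre. The bound is asked only up to eps on one circle, because
    quotients such as w z / z are controlled only in the limit at the boundary. *)
Lemma center_bound (F : C -> C) (B : R) :
  (forall w, inD w -> w <> RtoC 0 -> exists l, cder F w l) ->
  ccont F (RtoC 0) ->
  (forall eps, 0 < eps -> exists r, 0 < r < 1 /\
     forall w, Cmod w = r -> Cmod (F w) <= B + eps) ->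
  Cmod (F (RtoC 0)) <= B.
Proof.
intros HF H0 HB; apply le_epsilon; intros eps Heps.
destruct (HB eps Heps) as (r & Hr & Hw).
assert (HPI := PI_RGT_0).
assert (HM := mean_value F r ltac:(lra)
  (fun w Hw => HF w (Rle_lt_trans _ _ _ Hw (proj2 Hr))) H0).
apply Rmult_le_reg_l with (2 * PI); [lra|].
rewrite <- (Cmod_RtoC_pos (2 * PI)) at 1 by lra.
rewrite <- Cmod_mult, <- HM.
replace (2 * PI * (B + eps)) with ((2 * PI - 0) * (B + eps)) by ring.
apply CInt_bound.
- lra.
- apply circ_cont_on; intros t.
  assert (E := Cmod_scaled_circ r t ltac:(lra)).
  apply HF; [unfold inD; lra|apply Cmod_pos_nz; lra].
- intros t _; apply Hw, Cmod_scaled_circ; lra.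
Qed.

(** The automorphism of the disk that moves 0 to a; [mobius (- a)] is its inverse. *)
Definition mobius (a z : C) : C := ((z + a) / (RtoC 1 + Cconj a * z))%C.

Lemma mobius_den (a z : C) :
  Cmod (RtoC 1 + Cconj a * z) * Cmod (RtoC 1 + Cconj a * z) =
  Cmod (z + a) * Cmod (z + a)
  + (1 - Cmod a * Cmod a) * (1 - Cmod z * Cmod z).
Proof.
rewrite !Cmod_sqr; destruct a as [a b], z as [x y].
unfold Cconj, RtoC, Cplus, Cmult, Re, Im; simpl; ring.
Qed.

Lemma mobius_den_neq_0 (a z : C) : inD a -> Cmod z <= 1 ->
  (RtoC 1 + Cconj a * z)%C <> RtoC 0.
Proof.
unfold inD; intros Ha Hz H; assert (Ha0 := Cmod_ge_0 a); assert (Hz0 := Cmod_ge_0 z).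
assert (E : Cmod (Cconj a * z) = 1).
{ replace (Cconj a * z)%C with ((RtoC 1 + Cconj a * z) - RtoC 1)%C by ring.
  rewrite H; replace (RtoC 0 - RtoC 1)%C with (- RtoC 1)%C by ring.
  rewrite Cmod_opp; apply Cmod_1. }
rewrite Cmod_mult, Cmod_conj in E; nra.
Qed.

Lemma mobius_le_1 (a z : C) : inD a -> Cmod z <= 1 -> Cmod (mobius a z) <= 1.
Proof.
intros Ha Hz; assert (N := mobius_den_neq_0 a z Ha Hz).
assert (P := proj1 (Cmod_gt_0 _) N).
unfold mobius; rewrite Cmod_div by exact N.
apply Rmult_le_reg_r with (1 := P).
unfold Rdiv; rewrite Rmult_assoc, Rinv_l, Rmult_1_r by lra.
assert (D := mobius_den a z).
assert (Ha0 := Cmod_ge_0 a); assert (Hz0 := Cmod_ge_0 z); unfold inD in Ha.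
assert (Q := Cmod_ge_0 (z + a)).
assert (0 <= (1 - Cmod a * Cmod a) * (1 - Cmod z * Cmod z)) by (apply Rmult_le_pos; nra).
nra.
Qed.

Lemma mobius_inD (a z : C) : inD a -> inD z -> inD (mobius a z).
Proof.
unfold inD; intros Ha Hz; assert (N := mobius_den_neq_0 a z Ha ltac:(lra)).
assert (P := proj1 (Cmod_gt_0 _) N).
unfold mobius; rewrite Cmod_div by exact N.
apply Rmult_lt_reg_r with (1 := P).
unfold Rdiv; rewrite Rmult_assoc, Rinv_l, Rmult_1_r by lra.
assert (D := mobius_den a z).
assert (Ha0 := Cmod_ge_0 a); assert (Hz0 := Cmod_ge_0 z).
assert (Q := Cmod_ge_0 (z + a)).
assert (0 < (1 - Cmod a * Cmod a) * (1 - Cmod z * Cmod z)) by (apply Rmult_lt_0_compat; nra).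
nra.
Qed.

Lemma mobius_0 (a : C) : mobius a (RtoC 0) = a.
Proof.
unfold mobius; replace (RtoC 1 + Cconj a * RtoC 0)%C with (RtoC 1) by ring.
field; apply RtoC_neq_0; lra.
Qed.

Lemma cder_mobius (a z : C) : inD a -> Cmod z <= 1 ->
  cder (mobius a) z ((RtoC 1 - Cconj a * a) /
    ((RtoC 1 + Cconj a * z) * (RtoC 1 + Cconj a * z)))%C.
Proof.
intros Ha Hz; assert (N := mobius_den_neq_0 a z Ha Hz).
eapply cder_eq; [|apply cder_div; [exact N| |]].
2: apply cder_plus; [apply cder_id|apply cder_const].
2: apply cder_plus; [apply cder_const|apply cder_mult; [apply cder_const|apply cder_id]].
cbv beta; field; exact N.
Qed.

Lemma Cconj_mult_self (a : C) : (Cconj a * a)%C = RtoC (Cmod a * Cmod a).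
Proof.
rewrite Cmod_sqr; destruct a as [x y]; unfold Cconj, RtoC, Cmult, Re, Im; simpl.
f_equal; ring.
Qed.

(** Shows that points near the unit circle stay near it. By [mobius_den], 1 - m^2 = (1 - |a|^2) (1 -
    |z|^2) / |1 + conj(a) z|^2 for m = |mobius a z|, and the denominator is at least (1 - |a|)^2. *)
Lemma mobius_near_circle (a z : C) : inD a -> inD z ->
  1 - Cmod (mobius a z) <= (1 + 1) / (1 - Cmod a) * (1 - Cmod z * Cmod z).
Proof.
intros Ha Hz; assert (Hm := mobius_inD a z Ha Hz); unfold inD in *.
assert (N := mobius_den_neq_0 a z Ha ltac:(lra)).
assert (D := mobius_den a z).
assert (Ha0 := Cmod_ge_0 a); assert (Hz0 := Cmod_ge_0 z).
set (m := Cmod (mobius a z)) in *.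
assert (Hm0 : 0 <= m) by apply Cmod_ge_0.
assert (E : Cmod (z + a) = m * Cmod (RtoC 1 + Cconj a * z)).
{ unfold m, mobius; rewrite Cmod_div by exact N; field.
  apply Rgt_not_eq, Cmod_gt_0, N. }
assert (L : 1 - Cmod a <= Cmod (RtoC 1 + Cconj a * z)).
{ generalize (Cmod_le_sub (RtoC 1) (RtoC 1 + Cconj a * z)); rewrite Cmod_1.
  replace (RtoC 1 - (RtoC 1 + Cconj a * z))%C with (- (Cconj a * z))%C by ring.
  rewrite Cmod_opp, Cmod_mult, Cmod_conj; nra. }
set (q := Cmod (RtoC 1 + Cconj a * z)) in *.
rewrite E in D.
apply Rmult_le_reg_r with ((1 - Cmod a) * (1 - Cmod a)); [nra|].
replace ((1 + 1) / (1 - Cmod a) * (1 - Cmod z * Cmod z) * ((1 - Cmod a) * (1 - Cmod a)))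
  with (2 * (1 - Cmod a) * (1 - Cmod z * Cmod z)) by (field; lra).
set (A := Cmod a) in *; set (Z := 1 - Cmod z * Cmod z) in *.
assert (HZ : 0 < Z) by (unfold Z; nra).
apply Rle_trans with ((1 - m) * (q * q)).
- apply Rmult_le_compat_l; [lra|]; apply Rmult_le_compat; lra.
- assert ((1 - m) * (1 + m) * (q * q) = (1 - A) * (1 + A) * Z) by nra.
  assert (0 <= (1 - m) * m * (q * q)) by (repeat apply Rmult_le_pos; nra).
  assert (0 <= (1 - A) * (1 - A) * Z) by (repeat apply Rmult_le_pos; nra).
  nra.
Qed.

Definition schwarz (w : C -> C) : Prop :=
  analyticD w /\ (forall z, inD z -> inD (w z)) /\ w (RtoC 0) = RtoC 0.

Lemma inD_0 : inD (RtoC 0).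
Proof. unfold inD; rewrite Cmod_0; lra. Qed.

(** Schwarz's lemma at an arbitrary point: composition with [mobius a] brings a to the centre, and a
    circle of radius close to 1 is sent close to the unit circle, where |w p| < 1 gives |w p / p| <=
    1 + eps. *)
Lemma slope0_le_1 (w : C -> C) : schwarz w ->
  forall a, inD a -> Cmod (slope0 w a) <= 1.
Proof.
intros (Hw & HD & H0) a Ha; assert (Ha' := Ha); unfold inD in Ha'.
assert (Hh := analytic_slope0 w Hw H0).
assert (Hc : forall z, inD z -> exists l, cder (fun z => slope0 w (mobius a z)) z l).
{ intros z Hz; eexists; apply (cder_comp (slope0 w) (mobius a)).
  - apply analytic_cder; [exact Hh|apply mobius_inD; assumption].
  - apply cder_mobius; [exact Ha|left; exact Hz]. }
rewrite <- (mobius_0 a).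
apply (center_bound (fun z => slope0 w (mobius a z))).
- intros z Hz _; apply Hc, Hz.
- destruct (Hc _ inD_0) as [l Hl]; exact (cder_ccont _ _ _ Hl).
- intros eps Heps.
  set (c := (1 + 1) / (1 - Cmod a)).
  assert (Hc0 : 0 < c) by (apply Rdiv_lt_0_compat; lra).
  (* Chosen so that 1 - dl = 1 / (1 + eps). *)
  set (dl := eps / (1 + eps)).
  assert (Hdl : 0 < dl) by (apply Rdiv_lt_0_compat; lra).
  (* On the circle of radius 1 - q one has c (1 - |z|^2) <= 2 c q <= dl. *)
  set (q := Rmin (1 / 2) (dl / (2 * c))).
  assert (Hq : 0 < q) by (apply Rmin_pos; [lra|apply Rdiv_lt_0_compat; lra]).
  assert (Hq1 : q <= 1 / 2) by apply Rmin_l.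
  assert (Hq2 : q <= dl / (2 * c)) by apply Rmin_r.
  exists (1 - q); split; [lra|]; intros z Hz.
  assert (HzD : inD z) by (unfold inD; lra).
  assert (Hn := mobius_near_circle a z Ha HzD); fold c in Hn; rewrite Hz in Hn.
  set (p := mobius a z) in *.
  assert (HpD : inD p) by (apply mobius_inD; assumption).
  assert (Hp : 1 - dl <= Cmod p).
  { assert (c * (1 - (1 - q) * (1 - q)) <= c * (2 * (dl / (2 * c)))).
    { apply Rmult_le_compat_l; nra. }
    replace (c * (2 * (dl / (2 * c)))) with dl in H by (field; lra); lra. }
  assert (E : Cmod (w p) = Cmod p * Cmod (slope0 w p)).
  { rewrite (slope0_spec w p H0) at 1; apply Cmod_mult. }
  assert (H1 := HD p HpD); unfold inD in H1; rewrite E in H1.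
  assert (Hs := Cmod_ge_0 (slope0 w p)).
  replace (1 - dl) with (/ (1 + eps)) in Hp by (unfold dl; field; lra).
  apply Rmult_le_reg_l with (/ (1 + eps)); [apply Rinv_0_lt_compat; lra|].
  rewrite Rinv_l by lra.
  apply Rle_trans with (Cmod p * Cmod (slope0 w p)); [|lra].
  apply Rmult_le_compat_r; assumption.
Qed.

Lemma slope0_0 (f : C -> C) : slope0 f (RtoC 0) = C_derive f (RtoC 0).
Proof.
unfold slope0; destruct (Ceq_dec (RtoC 0) (RtoC 0)) as [_|N]; [reflexivity|].
exfalso; apply N; reflexivity.
Qed.

Lemma derivative_at_0_le_1 (V : C -> C) : analyticD V -> V (RtoC 0) = RtoC 0 ->
  (forall z, inD z -> Cmod (V z) <= 1) -> Cmod (C_derive V (RtoC 0)) <= 1.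
Proof.
intros HV H0 HB; assert (Hh := analytic_slope0 V HV H0).
rewrite <- slope0_0; apply (center_bound (slope0 V)).
- intros w Hw _; eexists; apply (analytic_cder _ Hh w Hw).
- exact (cder_ccont _ _ _ (analytic_cder _ Hh _ inD_0)).
(* On this circle |V w / w| <= 1 / |w| = 1 + eps. *)
- intros eps Heps; exists (/ (1 + eps)).
  assert (Hr : 0 < / (1 + eps)) by (apply Rinv_0_lt_compat; lra).
  assert (Hr1 : / (1 + eps) < 1).
  { rewrite <- Rinv_1; apply Rinv_lt_contravar; lra. }
  split; [lra|]; intros w Hw.
  assert (Hb := HB w ltac:(unfold inD; lra)).
  rewrite (slope0_spec V w H0), Cmod_mult, Hw in Hb.
  apply Rmult_le_reg_l with (1 := Hr); rewrite Rinv_l by lra; exact Hb.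
Qed.

(** The bound on [h] is not strict because [slope0 w] is a unimodular constant when w is a rotation.
    For c < 1 the function c h maps into the open disk; moving a and c h(a) to 0 by automorphisms
    gives a function [V] fixing 0, to which Schwarz's lemma applies, and then c tends to 1. *)
Lemma Schwarz_Pick (h : C -> C) : analyticD h ->
  (forall z, inD z -> Cmod (h z) <= 1) -> forall a, inD a ->
  Cmod (C_derive h a) * (1 - Cmod a * Cmod a) <= 1 - Cmod (h a) * Cmod (h a).
Proof.
intros Hh HB a Ha; assert (Ha' := Ha); unfold inD in Ha'; assert (Ha0 := Cmod_ge_0 a).
assert (Hha := HB a Ha); assert (Hha0 := Cmod_ge_0 (h a)).
set (A := Cmod (C_derive h a) * (1 - Cmod a * Cmod a)).
assert (HA : 0 <= A) by (apply Rmult_le_pos; [apply Cmod_ge_0|nra]).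
set (q := Cmod (h a)) in *.
assert (K : forall c, 0 < c < 1 -> c * A <= 1 - c * c * (q * q)).
{ intros c Hc; set (b := (RtoC c * h a)%C).
  assert (Hb : Cmod b = c * q) by (unfold b; rewrite Cmod_mult, Cmod_RtoC_pos by lra; reflexivity).
  assert (HbD : inD (- b)) by (unfold inD; rewrite Cmod_opp, Hb; nra).
  set (k := fun z => (RtoC c * h (mobius a z))%C).
  assert (Hk : forall z, inD z -> inD (k z)).
  { intros z Hz; unfold inD, k; rewrite Cmod_mult, Cmod_RtoC_pos by lra.
    assert (B := HB _ (mobius_inD a z Ha Hz)); nra. }
  assert (Hkd : forall z, inD z -> cder k z (RtoC c * (C_derive h (mobius a z) *
     ((RtoC 1 - Cconj a * a) / ((RtoC 1 + Cconj a * z) * (RtoC 1 + Cconj a * z)))))%C).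
  { intros z Hz; unfold k; eapply cder_eq; [|apply cder_mult; [apply cder_const|
      apply (cder_comp h (mobius a))]].
    3: apply cder_mobius; [exact Ha|left; exact Hz].
    2: apply analytic_cder; [exact Hh|apply mobius_inD; assumption].
    cbv beta; ring. }
  set (V := fun z => mobius (- b) (k z)).
  assert (HVd : forall z, inD z -> cder V z
    ((RtoC 1 - Cconj (- b) * (- b)) / ((RtoC 1 + Cconj (- b) * k z) * (RtoC 1 + Cconj (- b) * k z))
     * (RtoC c * (C_derive h (mobius a z) *
     ((RtoC 1 - Cconj a * a) / ((RtoC 1 + Cconj a * z) * (RtoC 1 + Cconj a * z))))))%C).
  { intros z Hz; apply (cder_comp (mobius (- b)) k); [|apply Hkd, Hz].
    apply cder_mobius; [exact HbD|left; apply Hk, Hz]. }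
  assert (Hk0 : k (RtoC 0) = b) by (unfold k; rewrite mobius_0; reflexivity).
  assert (HV0 : V (RtoC 0) = RtoC 0).
  { unfold V; rewrite Hk0; unfold mobius; unfold Cdiv.
    replace (b + - b)%C with (RtoC 0) by ring; ring. }
  assert (HD := derivative_at_0_le_1 V (cder_analytic V _ HVd) HV0
    (fun z Hz => mobius_le_1 (- b) (k z) HbD (Rlt_le _ _ (Hk z Hz)))).
  rewrite (cder_C_derive V _ _ (HVd _ inD_0)), Hk0, mobius_0 in HD.
  rewrite Cconj_mult_self, Cmod_opp, Hb in HD.
  assert (E1 : (RtoC 1 + Cconj (- b) * b)%C = RtoC (1 - c * q * (c * q))).
  { replace (Cconj (- b) * b)%C with (- (Cconj b * b))%C.
    - rewrite Cconj_mult_self, Hb, RtoC_minus; ring.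
    - destruct b as [x y]; unfold Cconj, Cmult, Copp; simpl; f_equal; ring. }
  rewrite E1, Cconj_mult_self, <- !RtoC_minus in HD.
  replace (RtoC 1 + Cconj a * RtoC 0)%C with (RtoC 1) in HD by ring.
  assert (Hcq : 0 <= c * q <= c) by (split; nra).
  assert (Hd : 0 < 1 - c * q * (c * q)) by nra.
  set (d := 1 - c * q * (c * q)) in *.
  assert (Hdn : RtoC d <> RtoC 0) by (apply RtoC_neq_0; lra).
  assert (H1n : RtoC 1 <> RtoC 0) by (apply RtoC_neq_0; lra).
  match type of HD with Cmod ?x <= _ => replace x with
   (RtoC c * C_derive h a * RtoC (1 - Cmod a * Cmod a) / RtoC d)%C in HD
   by (field; first [exact Hdn|split; assumption]) end.
  rewrite Cmod_div in HD by exact Hdn.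
  rewrite !Cmod_mult in HD.
  rewrite (Cmod_RtoC_pos c), (Cmod_RtoC_pos d), (Cmod_RtoC_pos (1 - _)) in HD by (try lra; nra).
  apply Rmult_le_compat_r with (r := d) in HD; [|lra].
  unfold Rdiv in HD; rewrite Rmult_assoc, Rinv_l, Rmult_1_r, Rmult_1_l in HD by lra.
  unfold A; unfold d in HD; nra. }
destruct (Rle_lt_dec A (1 - q * q)) as [L|L]; [exact L|exfalso].
set (eta := A - (1 - q * q)).
assert (He : 0 < eta) by (unfold eta; lra).
(* Taking c = 1 - x in [K] gives eta <= x (A + 2) = eta / 2. *)
set (x := eta / (2 * (A + 2))).
assert (Hx : x * (2 * (A + 2)) = eta) by (unfold x; field; lra).
assert (Hx0 : 0 < x) by (apply Rdiv_lt_0_compat; lra).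
assert (Hq : 0 <= q * q <= 1) by nra.
assert (Hx1 : x < 1) by (unfold eta in *; nra).
specialize (K (1 - x) ltac:(lra)).
unfold eta in *; nra.
Qed.

(* Dieudonne's lemma, obtained by applying Schwarz-Pick to [w z / z]. *)
Lemma Dieudonne (w : C -> C) : schwarz w -> forall z, inD z ->
  Cmod (w z) <= Cmod z /\
  Cmod (z * C_derive w z - w z) * (1 - Cmod z * Cmod z)
  <= Cmod z * Cmod z - Cmod (w z) * Cmod (w z).
Proof.
intros Hs z Hz; assert (Hs' := Hs); destruct Hs' as (Hw & HD & H0).
assert (Hh := analytic_slope0 w Hw H0); assert (HB := slope0_le_1 w Hs).
assert (SP := Schwarz_Pick (slope0 w) Hh HB z Hz).
assert (Ew : Cmod (w z) = Cmod z * Cmod (slope0 w z)).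
{ rewrite (slope0_spec w z H0) at 1; apply Cmod_mult. }
assert (Hz0 := Cmod_ge_0 z); assert (HBz := HB z Hz).
assert (Hd : C_derive w z = (slope0 w z + z * C_derive (slope0 w) z)%C).
{ apply cder_C_derive.
  apply cder_ext_loc with (f := fun z => (z * slope0 w z)%C) (d0 := 1); [lra| |].
  - intros u _; symmetry; apply slope0_spec, H0.
  - eapply cder_eq; [|apply cder_mult; [apply cder_id|apply (analytic_cder _ Hh z Hz)]].
    cbv beta; ring. }
split; [rewrite Ew; nra|].
replace (z * C_derive w z - w z)%C with (z * z * C_derive (slope0 w) z)%C.
- rewrite !Cmod_mult, Ew.
  set (s := Cmod (slope0 w z)) in *; set (r := Cmod z) in *.
  assert (0 <= r * r) by nra.
  replace (r * r - r * s * (r * s)) with (r * r * (1 - s * s)) by ring.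
  rewrite Rmult_assoc; apply Rmult_le_compat_l; assumption.
- rewrite Hd, (slope0_spec w z H0) at 1; ring.
Qed.

(** * Radii for the cardioid domain *)

Lemma Re_Csqrt (z : C) : Re (Csqrt z) = sqrt ((Cmod z + Re z) / 2).
Proof. reflexivity. Qed.

Lemma Re_Csqrt_ge_0 (z : C) : 0 <= Re (Csqrt z).
Proof. rewrite Re_Csqrt; apply sqrt_pos. Qed.

Lemma Re_Csqrt_pos (z : C) : 0 < Cmod z + Re z -> 0 < Re (Csqrt z).
Proof. intros H; rewrite Re_Csqrt; apply sqrt_lt_R0; lra. Qed.

Lemma Cmod_Csqrt_sqr (z : C) : Cmod (Csqrt z) * Cmod (Csqrt z) = Cmod z.
Proof. rewrite <- Cmod_mult, Csqrt_mult; reflexivity. Qed.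

Lemma Re_le_Cmod (z : C) : Re z <= Cmod z.
Proof. exact (Rle_trans _ _ _ (Rle_abs _) (re_le_Cmod z)). Qed.

Lemma Re_plus (a b : C) : Re (a + b) = Re a + Re b.
Proof. reflexivity. Qed.

Lemma two_neq_0 : (RtoC 1 + RtoC 1)%C <> RtoC 0.
Proof. rewrite <- RtoC_plus; apply RtoC_neq_0; lra. Qed.

(** The hypothesis says that z is off the cut. Every value of [Csqrt] has nonnegative real part, on
    either side of the cut, so |s' + s| >= Re s > 0 for all w. Hence (s' - s) (s' + s) = w - z
    controls s' - s with no prior continuity, and the remainder is exactly -(s' - s)^2 / (2 s). *)
Lemma cder_Csqrt (z : C) : 0 < Cmod z + Re z ->
  cder Csqrt z (/ ((RtoC 1 + RtoC 1) * Csqrt z))%C.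
Proof.
intros Hz; assert (Hc := Re_Csqrt_pos z Hz).
set (s := Csqrt z) in *; set (c := Re s) in *.
assert (Hcs : c <= Cmod s) by apply Re_le_Cmod.
assert (Hs0 : s <> RtoC 0) by (apply Cmod_pos_nz; lra).
assert (Hc2 : 0 < c * c) by (apply Rmult_lt_0_compat; exact Hc).
assert (Hc3 : 0 < 2 * c * c * c).
{ replace (2 * c * c * c) with (2 * (c * (c * c))) by ring.
  apply Rmult_lt_0_compat; [lra|apply Rmult_lt_0_compat; assumption]. }
(* From |s' - s| <= h / c and |s| >= c the remainder is at most h^2 / (2 c^3). *)
intros eps Heps; exists (eps * (2 * c * c * c)); split; [nra|]; intros w Hw.
set (s' := Csqrt w).
assert (Hp : c <= Cmod (s' + s)).
{ eapply Rle_trans; [|apply Re_le_Cmod]; rewrite Re_plus.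
  generalize (Re_Csqrt_ge_0 w); fold s' c; lra. }
assert (Hd : (w - z)%C = ((s' - s) * (s' + s))%C).
{ replace ((s' - s) * (s' + s))%C with (s' * s' - s * s)%C by ring.
  unfold s', s; rewrite !Csqrt_mult; reflexivity. }
assert (Hsm : (s' - s - / ((RtoC 1 + RtoC 1) * s) * (w - z))%C =
  (- ((s' - s) * (s' - s)) / ((RtoC 1 + RtoC 1) * s))%C).
{ rewrite Hd; field; repeat split; first [exact Hs0|exact two_neq_0]. }
fold s s'; rewrite Hsm, Cmod_div by (apply Cmult_neq_0; [exact two_neq_0|exact Hs0]).
rewrite Cmod_opp, !Cmod_mult, <- RtoC_plus, Cmod_RtoC_pos by lra.
assert (Hm : Cmod (w - z) = Cmod (s' - s) * Cmod (s' + s)) by (rewrite Hd; apply Cmod_mult).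
set (x := Cmod (s' - s)) in *; set (h := Cmod (w - z)) in *.
assert (Hx0 : 0 <= x) by apply Cmod_ge_0.
assert (Hxc : x * c <= h) by (rewrite Hm; apply Rmult_le_compat_l; assumption).
apply Rmult_le_reg_r with ((1 + 1) * Cmod s); [lra|].
unfold Rdiv; rewrite Rmult_assoc, Rinv_l, Rmult_1_r by lra.
apply Rmult_le_reg_r with (c * c); [exact Hc2|].
assert (Hxc0 : 0 <= x * c) by (apply Rmult_le_pos; [exact Hx0|left; exact Hc]).
assert (Hxx : x * x * (c * c) <= h * h).
{ replace (x * x * (c * c)) with (x * c * (x * c)) by ring.
  apply Rmult_le_compat; assumption. }
apply Rle_trans with (1 := Hxx).
assert (Hh0 : 0 <= h) by apply Cmod_ge_0.
apply Rle_trans with (h * (eps * (2 * c * c * c))); [apply Rmult_le_compat_l; lra|].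
assert (0 <= eps * h * (c * c)) by (repeat apply Rmult_le_pos; lra).
nra.
Qed.

(** * Filled values at 0 and the cardioid domain *)

Lemma C_lim_eq (g h : C -> C) (z : C) (d : R) : 0 < d ->
  (forall w, Cmod (w - z) < d -> w <> z -> h w = g w) ->
  ccont g z -> C_lim h z = g z.
Proof.
intros Hd He Hg; apply is_C_lim_unique; apply filterlim_locally; intros eps.
destruct (Hg eps (cond_pos eps)) as (d' & Hd' & H).
assert (Hm : 0 < Rmin d d' / 2) by (generalize (Rmin_pos _ _ Hd Hd'); lra).
exists (mkposreal _ Hm); intros w [B1 B2] Hw.
change (Rabs (fst w - fst z) < Rmin d d' / 2) in B1.
change (Rabs (snd w - snd z) < Rmin d d' / 2) in B2.
assert (Bw : Cmod (w - z) < Rmin d d').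
{ eapply Rle_lt_trans; [exact (Cmod_le_Rabs (fst (w - z)%C) (snd (w - z)%C))|].
  change (Rabs (fst w - fst z) + Rabs (snd w - snd z) < Rmin d d'); lra. }
rewrite (He w (Rlt_le_trans _ _ _ Bw (Rmin_l _ _)) Hw).
specialize (H w (Rlt_le_trans _ _ _ Bw (Rmin_r _ _))).
split.
- exact (Rle_lt_trans _ _ _ (Rle_trans _ _ _ (Rmax_l _ _) (Rmax_Cmod _)) H).
- exact (Rle_lt_trans _ _ _ (Rle_trans _ _ _ (Rmax_r _ _) (Rmax_Cmod _)) H).
Qed.

Lemma fill0_eq (g h : C -> C) : analyticD g ->
  (forall z, inD z -> z <> RtoC 0 -> h z = g z) ->
  forall z, inD z -> fill0 h z = g z.
Proof.
intros Hg He z Hz; unfold fill0; destruct (Ceq_dec z (RtoC 0)) as [->|N].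
- apply C_lim_eq with (d := 1); [lra| |].
  + intros w Hw N; apply He; [|exact N].
    unfold inD; replace (w - RtoC 0)%C with w in Hw by ring; exact Hw.
  + exact (cder_ccont _ _ _ (analytic_cder g Hg _ inD_0)).
- apply He; assumption.
Qed.

(* The square of [u + 1] when [s = cardioid u]. *)
Definition card_sqr (s : C) : C := (RtoC (3 / 2) * s - RtoC (1 / 2))%C.

(* In polar coordinates of [card_sqr s] this reads [rho < 2 (1 + cos theta)]. *)
Definition in_cardioid (s : C) : Prop :=
  Cmod (card_sqr s) * Cmod (card_sqr s) <
  2 * Cmod (card_sqr s) + 2 * Re (card_sqr s).

Lemma Cmod_minus_1_sqr (v : C) :
  Cmod (v - RtoC 1) * Cmod (v - RtoC 1) = Cmod v * Cmod v + 1 - 2 * Re v.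
Proof.
rewrite !Cmod_sqr; destruct v as [x y]; unfold RtoC, Cminus, Cplus, Copp, Re, Im; simpl; ring.
Qed.

Lemma card_sqr_cardioid (u : C) :
  card_sqr (cardioid u) = ((u + RtoC 1) * (u + RtoC 1))%C.
Proof.
unfold card_sqr, cardioid; destruct u as [x y].
unfold RtoC, Cminus, Cplus, Copp, Cmult; simpl; f_equal; field.
Qed.

Lemma cardioid_of_sqr (s v : C) : (v * v)%C = card_sqr s -> cardioid (v - RtoC 1) = s.
Proof.
intros H; replace s with (RtoC (2 / 3) * card_sqr s + RtoC (1 / 3))%C.
- rewrite <- H; unfold cardioid; destruct v as [x y].
  unfold RtoC, Cminus, Cplus, Copp, Cmult; simpl; f_equal; field.
- unfold card_sqr; destruct s as [x y].
  unfold RtoC, Cminus, Cplus, Copp, Cmult; simpl; f_equal; field.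
Qed.

(** With v = u + 1, |u| < 1 means |v|^2 < 2 Re v. As [card_sqr] is v^2 and Re (v^2) = 2 (Re v)^2 -
    |v|^2, the cardioid condition reads |v|^4 < 4 (Re v)^2. *)
Lemma in_cardioid_image (u : C) : inD u -> in_cardioid (cardioid u).
Proof.
unfold inD, in_cardioid; intros Hu; rewrite card_sqr_cardioid, Cmod_mult.
set (v := (u + RtoC 1)%C).
assert (E := Cmod_minus_1_sqr v).
replace (v - RtoC 1)%C with u in E by (unfold v; ring).
assert (Hu0 := Cmod_ge_0 u).
assert (Hv := Cmod_sqr v).
assert (E2 : Re (v * v) = 2 * (Re v * Re v) - Cmod v * Cmod v).
{ rewrite Hv; destruct v as [x y]; unfold Cmult, Re, Im; simpl; ring. }
rewrite E2; set (m := Cmod v * Cmod v) in *.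
assert (Hm : 0 <= m) by (unfold m; nra).
assert (m < 2 * Re v) by nra.
nra.
Qed.

(** For |u| < 1 the number u + 1 has positive real part, so it is the principal root of its
    square. *)
Definition cardioid_inv (s : C) : C := (Csqrt (card_sqr s) - RtoC 1)%C.

Lemma in_cardioid_slit (s : C) : in_cardioid s -> 0 < Cmod (card_sqr s) + Re (card_sqr s).
Proof. unfold in_cardioid; intros H; generalize (Cmod_ge_0 (card_sqr s)); nra. Qed.

Lemma cardioid_inv_inD (s : C) : in_cardioid s -> inD (cardioid_inv s).
Proof.
intros Hs; assert (Hp := in_cardioid_slit s Hs); unfold in_cardioid in Hs.
unfold inD, cardioid_inv; set (t := card_sqr s) in *.
assert (E := Cmod_minus_1_sqr (Csqrt t)); rewrite Cmod_Csqrt_sqr, Re_Csqrt in E.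
assert (Hq := sqrt_sqrt ((Cmod t + Re t) / 2) ltac:(lra)).
assert (Hq0 := sqrt_lt_R0 ((Cmod t + Re t) / 2) ltac:(lra)).
set (q := sqrt ((Cmod t + Re t) / 2)) in *.
assert (Ht := Cmod_ge_0 t).
assert (Hx := Cmod_ge_0 (Csqrt t - RtoC 1)).
(* Since q^2 = (|t| + Re t) / 2, the cardioid condition is |t|^2 < 4 q^2. *)
assert (Cmod t < 2 * q) by nra.
nra.
Qed.

Lemma cardioid_invK (s : C) : cardioid (cardioid_inv s) = s.
Proof. apply cardioid_of_sqr, Csqrt_mult. Qed.

Lemma cardioid_inv_1 : cardioid_inv (RtoC 1) = RtoC 0.
Proof.
unfold cardioid_inv, card_sqr.
replace (RtoC (3 / 2) * RtoC 1 - RtoC (1 / 2))%C with (RtoC 1).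
- assert (E := Cmod_minus_1_sqr (Csqrt (RtoC 1))).
  rewrite Cmod_Csqrt_sqr, Re_Csqrt, Cmod_1 in E.
  replace ((1 + Re (RtoC 1)) / 2) with 1 in E by (unfold RtoC, Re; simpl; lra).
  rewrite sqrt_1 in E; apply Cmod_eq_0; nra.
- rewrite <- RtoC_mult, <- RtoC_minus; f_equal; lra.
Qed.

Lemma cder_cardioid_inv (s : C) : in_cardioid s -> exists l, cder cardioid_inv s l.
Proof.
intros Hs; eexists; apply cder_minus; [|apply cder_const].
apply (cder_comp Csqrt card_sqr).
- apply cder_Csqrt, in_cardioid_slit, Hs.
- apply cder_minus; [apply cder_mult; [apply cder_const|apply cder_id]|apply cder_const].
Qed.

(* [S] is the analytic function [z f' / f] with its singularity removed. *)
Definition has_zlogder (f S : C -> C) : Prop :=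
  classA f /\ analyticD S /\ S (RtoC 0) = RtoC 1 /\
  forall z, inD z -> z <> RtoC 0 -> (z * C_derive f z / f z)%C = S z.

(** * Starlikeness of dilations as a pointwise condition, and existence of rho_f *)

Lemma cder_dilate (f : C -> C) (r : R) : analyticD f -> 0 < r <= 1 ->
  forall z, inD z -> cder (dilate r f) z (C_derive f (RtoC r * z)).
Proof.
intros Hf Hr z Hz; assert (Hr0 : RtoC r <> RtoC 0) by (apply RtoC_neq_0; lra).
eapply cder_eq; [|apply cder_mult; [|apply cder_const]].
2: apply (cder_comp f (fun z => RtoC r * z)%C).
3: apply cder_mult; [apply cder_const|apply cder_id].
2: apply analytic_cder; [exact Hf|unfold inD in *; rewrite Cmod_mult, Cmod_RtoC_pos by lra].
- cbv beta; field; exact Hr0.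
- generalize (Cmod_ge_0 z); nra.
Qed.

Lemma Cdiv_0_r (z : C) : (z / RtoC 0)%C = RtoC 0.
Proof.
unfold Cdiv; replace (/ RtoC 0)%C with (RtoC 0); [ring|].
unfold Cinv, RtoC; simpl; f_equal; unfold Rdiv; ring.
Qed.

(** The expression z f'/f of the dilation is S(r z). If its values lie in the cardioid domain,
    [cardioid_inv] composed with it is the required Schwarz function. *)
Lemma starlike_c_dilate (f S : C -> C) (r : R) : has_zlogder f S -> 0 < r <= 1 ->
  starlike_c (dilate r f) <-> (forall z, Cmod z < r -> in_cardioid (S z)).
Proof.
intros ((Hf & Hf0 & Hf1) & HS & HS0 & HE) Hr.
assert (Hr0 : RtoC r <> RtoC 0) by (apply RtoC_neq_0; lra).
assert (HD : forall z, inD z -> Cmod (RtoC r * z) < r /\ inD (RtoC r * z)).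
{ intros z Hz; unfold inD in *; rewrite Cmod_mult, Cmod_RtoC_pos by lra.
  generalize (Cmod_ge_0 z); nra. }
assert (Hdil := cder_dilate f r Hf Hr).
set (T := fun z => S (RtoC r * z)%C).
assert (HTd : forall z, inD z -> cder T z (C_derive S (RtoC r * z) * RtoC r)%C).
{ intros z Hz; apply (cder_comp S (fun z => RtoC r * z)%C).
  - apply analytic_cder; [exact HS|apply HD, Hz].
  - eapply cder_eq; [|apply cder_mult; [apply cder_const|apply cder_id]]; cbv beta; ring. }
assert (HF : forall z, inD z ->
  fill0 (fun z => z * C_derive (dilate r f) z / dilate r f z)%C z = T z).
{ apply fill0_eq; [exact (cder_analytic T _ HTd)|]; intros z Hz Hz0.
  rewrite (cder_C_derive _ _ _ (Hdil z Hz)).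
  assert (Hrz : (RtoC r * z)%C <> RtoC 0) by (apply Cmult_neq_0; assumption).
  unfold T; rewrite <- (HE _ (proj2 (HD z Hz)) Hrz); unfold dilate.
  (* At a zero of f both quotients have the default value 0. *)
  destruct (Ceq_dec (f (RtoC r * z)%C) (RtoC 0)) as [E|N].
  - rewrite E; replace (RtoC 0 / RtoC r)%C with (RtoC 0) by (field; exact Hr0).
    rewrite !Cdiv_0_r; reflexivity.
  - field; split; assumption. }
split.
- intros (_ & w & _ & Hw & _ & Hs) z Hz.
  assert (Hzr : inD (z / RtoC r)).
  { unfold inD; rewrite Cmod_div, Cmod_RtoC_pos by (try exact Hr0; lra).
    apply Rmult_lt_reg_r with r; [lra|].
    unfold Rdiv; rewrite Rmult_assoc, Rinv_l; lra. }
  specialize (Hs _ Hzr); rewrite HF in Hs by exact Hzr; unfold T in Hs.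
  replace (RtoC r * (z / RtoC r))%C with z in Hs by (field; exact Hr0).
  rewrite Hs; apply in_cardioid_image, Hw, Hzr.
- intros H; split; [split; [|split]|].
  + exact (cder_analytic _ _ Hdil).
  + unfold dilate; rewrite Cmult_0_r, Hf0; unfold Cdiv; ring.
  + rewrite (cder_C_derive _ _ _ (Hdil _ inD_0)), Cmult_0_r; exact Hf1.
  + exists (fun z => cardioid_inv (T z)); split; [|split; [|split]].
    * intros z Hz.
      destruct (cder_cardioid_inv (T z) (H _ (proj1 (HD z Hz)))) as [l Hl].
      eexists; apply is_derive_cder, (cder_comp cardioid_inv T); [exact Hl|apply HTd, Hz].
    * intros z Hz; apply cardioid_inv_inD, H, HD, Hz.
    * unfold T; rewrite Cmult_0_r, HS0; exact cardioid_inv_1.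
    * intros z Hz; rewrite HF by exact Hz; symmetry; apply cardioid_invK.
Qed.

(** A condition on the disk |z| < rho passes to smaller disks, so the quantifier over r reduces to r
    = rho. *)
Lemma holds_up_to_starlike_c (f S : C -> C) (rho : R) : has_zlogder f S ->
  holds_up_to starlike_c f rho <->
  0 < rho <= 1 /\ forall z, Cmod z < rho -> in_cardioid (S z).
Proof.
intros HS; split; intros [Hr H]; split; try exact Hr.
- apply (starlike_c_dilate f S rho HS Hr), H; lra.
- intros r Hr'; apply (starlike_c_dilate f S r HS ltac:(lra)).
  intros z Hz; apply H; lra.
Qed.

(** The supremum of the admissible radii is attained, because the condition concerns open disks and
    the disk of radius rho is the union of the smaller ones. *)
Lemma is_rho_exists (f S : C -> C) (rad : R) : has_zlogder f S -> 0 < rad <= 1 ->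
  (forall z, Cmod z < rad -> in_cardioid (S z)) ->
  exists rho, is_rho starlike_c f rho.
Proof.
intros HS Hr H.
destruct (completeness (holds_up_to starlike_c f)) as [rho [Hu Hl]].
- exists 1; intros x [Hx _]; lra.
- exists rad; apply (holds_up_to_starlike_c f S); auto.
- assert (Hrad : rad <= rho) by (apply Hu, (holds_up_to_starlike_c f S); auto).
  exists rho; split; [|exact Hu].
  apply (holds_up_to_starlike_c f S); [exact HS|split].
  + split; [lra|]; apply Hl; intros x [Hx _]; lra.
  + intros z Hz.
    (* If no admissible x exceeds |z|, then |z| is an upper bound of the admissible radii, so rho <=
       |z|. *)
    destruct (Classical_Prop.classic
      (exists x, holds_up_to starlike_c f x /\ Cmod z < x)) as [(x & Hx & Hzx)|N].
    * apply (holds_up_to_starlike_c f S x HS) in Hx; apply Hx, Hzx.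
    * exfalso; apply (Rlt_not_le _ _ Hz), Hl; intros x Hx.
      destruct (Rle_lt_dec x (Cmod z)) as [L|L]; [exact L|].
      exfalso; apply N; exists x; auto.
Qed.

(* [L] is the logarithmic derivative of the zero-free function [phi]. *)
Definition logder (phi L : C -> C) : Prop :=
  (forall u, inD u -> phi u <> RtoC 0 /\ cder phi u (L u * phi u)%C) /\
  analyticD L /\ phi (RtoC 0) = RtoC 1.

(** This is z (phi o w)' / (phi o w) when [L] is the logarithmic derivative of phi. *)
Definition zlogder_comp (L w : C -> C) (z : C) : C := (z * C_derive w z * L (w z))%C.

Lemma analytic_zlogder_comp (L w : C -> C) :
  analyticD L -> schwarz w -> analyticD (zlogder_comp L w).
Proof.
intros HL (Hw & HD & _).
assert (Hw' := analytic_derivative w Hw).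
intros z Hz; eexists; apply is_derive_cder.
apply cder_mult; [apply cder_mult; [apply cder_id|apply analytic_cder; assumption]|].
apply (cder_comp L w); apply analytic_cder; try assumption; apply HD, Hz.
Qed.

Lemma cder_logder_comp (phi L w : C -> C) (z : C) : logder phi L -> schwarz w ->
  inD z -> cder (fun z => phi (w z)) z (L (w z) * phi (w z) * C_derive w z)%C.
Proof.
intros (HL & _ & _) (Hw & HD & _) Hz; apply (cder_comp phi w).
- apply HL, HD, Hz.
- apply analytic_cder; assumption.
Qed.

Definition ratio_zlogder (L K w1 w2 w3 : C -> C) (z : C) : C :=
  (RtoC 1 + zlogder_comp L w1 z + zlogder_comp L w2 z + zlogder_comp K w3 z)%C.

Lemma product_cder (phi psi L K w1 w2 w3 f : C -> C) :
  logder phi L -> logder psi K -> schwarz w1 -> schwarz w2 -> schwarz w3 ->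
  (forall z, inD z -> f z = (z * (phi (w1 z) * phi (w2 z) * psi (w3 z)))%C) ->
  forall z, inD z -> cder f z
    (phi (w1 z) * phi (w2 z) * psi (w3 z) * ratio_zlogder L K w1 w2 w3 z)%C.
Proof.
intros Hphi Hpsi H1 H2 H3 Hf z Hz; unfold inD in Hz.
apply cder_ext_loc with (d0 := 1 - Cmod z)
  (f := fun z => (z * (phi (w1 z) * phi (w2 z) * psi (w3 z)))%C); [lra| |].
- intros w Hw; symmetry; apply Hf; unfold inD.
  generalize (Cmod_le_sub w z); lra.
- eapply cder_eq; [|apply cder_mult; [apply cder_id|apply cder_mult; [apply cder_mult|]]].
  2: apply (cder_logder_comp phi L w1 z Hphi H1 Hz).
  2: apply (cder_logder_comp phi L w2 z Hphi H2 Hz).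
  2: apply (cder_logder_comp psi K w3 z Hpsi H3 Hz).
  unfold ratio_zlogder, zlogder_comp; cbv beta; ring.
Qed.

Lemma product_has_zlogder (phi psi L K w1 w2 w3 f : C -> C) :
  logder phi L -> logder psi K -> schwarz w1 -> schwarz w2 -> schwarz w3 ->
  (forall z, inD z -> f z = (z * (phi (w1 z) * phi (w2 z) * psi (w3 z)))%C) ->
  has_zlogder f (ratio_zlogder L K w1 w2 w3).
Proof.
intros Hphi Hpsi H1 H2 H3 Hf.
assert (Hd := product_cder phi psi L K w1 w2 w3 f Hphi Hpsi H1 H2 H3 Hf).
assert (HS0 : ratio_zlogder L K w1 w2 w3 (RtoC 0) = RtoC 1).
{ unfold ratio_zlogder, zlogder_comp; ring. }
split; [split; [|split]|split; [|split]].
- exact (cder_analytic f _ Hd).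
- rewrite Hf by exact inD_0; ring.
- rewrite (cder_C_derive _ _ _ (Hd _ inD_0)), HS0.
  destruct Hphi as (_ & _ & E1), Hpsi as (_ & _ & E2).
  destruct H1 as (_ & _ & Z1), H2 as (_ & _ & Z2), H3 as (_ & _ & Z3).
  rewrite Z1, Z2, Z3, E1, E2; ring.
- assert (A1 := analytic_zlogder_comp L w1 (proj1 (proj2 Hphi)) H1).
  assert (A2 := analytic_zlogder_comp L w2 (proj1 (proj2 Hphi)) H2).
  assert (A3 := analytic_zlogder_comp K w3 (proj1 (proj2 Hpsi)) H3).
  intros z Hz; eexists; apply is_derive_cder.
  apply cder_plus; [apply cder_plus; [apply cder_plus; [apply cder_const|]|]|];
   apply analytic_cder; assumption.
- exact HS0.
- intros z Hz Hz0; rewrite (cder_C_derive _ _ _ (Hd _ Hz)), (Hf z Hz).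
  destruct Hphi as (E1 & _), Hpsi as (E2 & _).
  destruct (E1 (w1 z)) as [N1 _]; [apply H1, Hz|].
  destruct (E1 (w2 z)) as [N2 _]; [apply H2, Hz|].
  destruct (E2 (w3 z)) as [N3 _]; [apply H3, Hz|].
  field; repeat split; assumption.
Qed.

(** * Factorisation of the classes, the extremal function and the criterion for the radius *)

Lemma fill0_neq_0 (h : C -> C) (z : C) : z <> RtoC 0 -> fill0 h z = h z.
Proof. intros N; unfold fill0; destruct (Ceq_dec z (RtoC 0)); [contradiction|reflexivity]. Qed.

(** Write f = z (f / g) (g / (z p)) p and replace each factor by its subordinate form. *)
Lemma ratio_class_factor (phi psi L K f : C -> C) :
  logder phi L -> logder psi K -> ratio_class phi psi f ->
  exists w1 w2 w3, schwarz w1 /\ schwarz w2 /\ schwarz w3 /\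
   forall z, inD z -> f z = (z * (phi (w1 z) * phi (w2 z) * psi (w3 z)))%C.
Proof.
intros (Hphi & _) (Hpsi & _) ((_ & Hf0 & _) & g & p & _ & Hp & H1 & H2).
destruct H1 as (w1 & A1 & B1 & C1 & E1).
destruct H2 as (w2 & A2 & B2 & C2 & E2).
destruct Hp as (w3 & A3 & B3 & C3 & E3).
exists w1, w2, w3; split; [|split; [|split]]; try (split; [|split]; assumption).
intros z Hz; destruct (Ceq_dec z (RtoC 0)) as [->|N]; [rewrite Hf0; ring|].
specialize (E1 z Hz); specialize (E2 z Hz); specialize (E3 z Hz).
rewrite fill0_neq_0 in E1, E2 by exact N; cbv beta in E1, E2.
destruct (Hphi (w1 z) (B1 z Hz)) as [N1 _].
destruct (Hphi (w2 z) (B2 z Hz)) as [N2 _].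
destruct (Hpsi (w3 z) (B3 z Hz)) as [N3 _].
(* A zero of g would make the quotient 0 by default, but [phi] omits 0. *)
assert (Ng : g z <> RtoC 0) by (intros H; rewrite H, Cdiv_0_r in E1; auto).
rewrite <- E1, <- E2, E3; field; repeat split; assumption.
Qed.

Lemma schwarz_id : schwarz (fun z => z).
Proof.
split; [|split]; auto.
apply cder_analytic with (df := fun _ => RtoC 1); intros z _; apply cder_id.
Qed.

Lemma analytic_logder (phi L : C -> C) : logder phi L -> analyticD phi.
Proof. intros (H & _); exact (cder_analytic phi _ (fun z Hz => proj2 (H z Hz))). Qed.

Definition extremal (phi psi : C -> C) (z : C) : C := (z * (phi z * phi z * psi z))%C.

Lemma extremal_ratio_class (phi psi L K : C -> C) :
  logder phi L -> logder psi K -> ratio_class phi psi (extremal phi psi).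
Proof.
intros Hphi Hpsi.
assert (Hone : logder (fun _ => RtoC 1) (fun _ => RtoC 0)).
{ split; [intros u _; split; [apply RtoC_neq_0; lra|]|split; [|reflexivity]].
  - rewrite Cmult_0_l; apply cder_const.
  - apply cder_analytic with (df := fun _ => RtoC 0); intros z _; apply cder_const. }
split.
- exact (proj1 (product_has_zlogder phi psi L K _ _ _ _ Hphi Hpsi
    schwarz_id schwarz_id schwarz_id (fun z _ => eq_refl))).
(* With this g and p = psi both quotients equal [phi], so the identity serves as Schwarz function
   throughout. *)
- exists (fun z => z * (phi z * psi z))%C, psi; split; [|split; [|split]].
  + assert (A : forall z, inD z -> cder (fun z => z * (phi z * psi z))%C z
       (phi z * psi z * (RtoC 1 + z * (L z + K z)))%C).
    { intros z Hz; eapply cder_eq; [|apply cder_mult; [apply cder_id|apply cder_mult]].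
      2: apply (proj1 Hphi z Hz).
      2: apply (proj1 Hpsi z Hz).
      cbv beta; ring. }
    split; [exact (cder_analytic _ _ A)|split; [ring|]].
    rewrite (cder_C_derive _ _ _ (A _ inD_0)).
    rewrite (proj2 (proj2 Hphi)), (proj2 (proj2 Hpsi)); ring.
  + exists (fun z => z); destruct schwarz_id as (I1 & I2 & I3); auto.
  + exists (fun z => z); destruct schwarz_id as (I1 & I2 & I3).
    split; [exact I1|split; [exact I2|split; [exact I3|]]].
    apply fill0_eq; [apply (analytic_logder phi L Hphi)|].
    intros z Hz Hz0; unfold extremal.
    destruct (proj1 Hphi z Hz) as [N1 _], (proj1 Hpsi z Hz) as [N2 _].
    field; repeat split; assumption.
  + exists (fun z => z); destruct schwarz_id as (I1 & I2 & I3).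
    split; [exact I1|split; [exact I2|split; [exact I3|]]].
    apply fill0_eq; [apply (analytic_logder phi L Hphi)|].
    intros z Hz Hz0.
    destruct (proj1 Hphi z Hz) as [N1 _], (proj1 Hpsi z Hz) as [N2 _].
    field; repeat split; assumption.
Qed.

(** The inclusion hypothesis bounds every rho_f below by [rad]. The last hypothesis says that z f'/f
    of the extremal function equals 1 - 2/3 at -rad, the cusp, so that its rho_f cannot exceed [rad]
    and the infimum is attained. *)
Lemma is_radius_ratio_class (phi psi L K : C -> C) (rad : R) :
  logder phi L -> logder psi K -> 0 < rad < 1 ->
  (forall w1 w2 w3, schwarz w1 -> schwarz w2 -> schwarz w3 ->
     forall z, Cmod z < rad -> in_cardioid (ratio_zlogder L K w1 w2 w3 z)) ->
  (RtoC rad * (L (- RtoC rad) + L (- RtoC rad) + K (- RtoC rad)))%C = RtoC (2 / 3) ->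
  is_radius starlike_c (ratio_class phi psi) rad.
Proof.
intros Hphi Hpsi Hr Hin Hext.
assert (HZ : forall f, ratio_class phi psi f -> exists S, has_zlogder f S /\
  forall z, Cmod z < rad -> in_cardioid (S z)).
{ intros f Hf.
  destruct (ratio_class_factor phi psi L K f Hphi Hpsi Hf) as (w1 & w2 & w3 & H1 & H2 & H3 & E).
  exists (ratio_zlogder L K w1 w2 w3); split; [|apply Hin; assumption].
  apply (product_has_zlogder phi psi); assumption. }
assert (HR : forall f, ratio_class phi psi f -> exists rho, is_rho starlike_c f rho).
{ intros f Hf; destruct (HZ f Hf) as (S & HS & H).
  apply (is_rho_exists f S rad); [exact HS|lra|exact H]. }
assert (HL : forall f rho, ratio_class phi psi f -> is_rho starlike_c f rho -> rad <= rho).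
{ intros f rho Hf [_ Hrho]; destruct (HZ f Hf) as (S & HS & H); apply Hrho.
  apply (holds_up_to_starlike_c f S); [exact HS|split; [lra|exact H]]. }
split; [exact HR|split].
- intros rho (f & Hf & Hrho); exact (HL f rho Hf Hrho).
- intros b Hb.
  assert (HE := extremal_ratio_class phi psi L K Hphi Hpsi).
  destruct (HR _ HE) as [rho Hrho].
  assert (HX := product_has_zlogder phi psi L K _ _ _ (extremal phi psi) Hphi Hpsi
    schwarz_id schwarz_id schwarz_id (fun z _ => eq_refl)).
  assert (Hle : rho <= rad).
  { destruct (Rle_lt_dec rho rad) as [Hle|Hlt]; [exact Hle|exfalso].
    destruct Hrho as [Hh _]; apply (holds_up_to_starlike_c _ _ _ HX) in Hh.
    destruct Hh as [_ Hh].
    specialize (Hh (- RtoC rad)%C).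
    rewrite Cmod_opp, Cmod_RtoC_pos in Hh by lra; specialize (Hh Hlt).
    assert (E : ratio_zlogder L K (fun z => z) (fun z => z) (fun z => z) (- RtoC rad)
      = RtoC (1 / 3)).
    { unfold ratio_zlogder, zlogder_comp.
      rewrite !(cder_C_derive _ _ _ (cder_id _)).
      replace (RtoC (1 / 3)) with (RtoC 1 - RtoC (2 / 3))%C
        by (rewrite <- RtoC_minus; f_equal; lra).
      rewrite <- Hext; ring. }
    (* At the cusp [card_sqr] vanishes and the condition becomes 0 < 0. *)
    rewrite E in Hh; unfold in_cardioid, card_sqr in Hh.
    replace (RtoC (3 / 2) * RtoC (1 / 3) - RtoC (1 / 2))%C with (RtoC 0) in Hh
      by (rewrite <- RtoC_mult, <- RtoC_minus; f_equal; field).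
    rewrite Cmod_0 in Hh; unfold RtoC, Re in Hh; simpl in Hh; lra. }
  assert (rho = rad) by (apply Rle_antisym; [exact Hle|apply (HL _ _ HE Hrho)]).
  subst rho; apply Hb; exists (extremal phi psi); auto.
Qed.

(** * The three radii *)

Lemma Re_ge_opp_Cmod (z : C) : - Cmod z <= Re z.
Proof. generalize (re_le_Cmod z) (Rabs_le_between (Re z) (Cmod z)); tauto. Qed.

Lemma Csqrt_real (x : R) : 0 <= x -> Csqrt (RtoC x) = RtoC (sqrt x).
Proof.
intros Hx; unfold Csqrt; rewrite Cmod_RtoC_pos by exact Hx.
unfold RtoC, Re, Im; simpl.
replace ((x + x) / 2) with x by field; replace ((x - x) / 2) with 0 by field.
rewrite sqrt_0; destruct (Rle_dec 0 0) as [_|N]; [reflexivity|lra].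
Qed.

Lemma slit_one_plus (u : C) : inD u ->
  0 < Cmod (RtoC 1 + u) + Re (RtoC 1 + u).
Proof.
unfold inD; intros Hu; generalize (Re_ge_opp_Cmod u) (Cmod_ge_0 (RtoC 1 + u)).
rewrite Re_plus; change (Re (RtoC 1)) with 1; lra.
Qed.

Lemma inD_sqr (u : C) : inD u -> inD (u * u).
Proof. unfold inD; rewrite Cmod_mult; generalize (Cmod_ge_0 u); nra. Qed.

Lemma Csqrt_neq_0 (z : C) : 0 < Cmod z + Re z -> Csqrt z <> RtoC 0.
Proof.
intros Hz; apply Cmod_pos_nz, Rlt_le_trans with (1 := Re_Csqrt_pos z Hz), Re_le_Cmod.
Qed.

Lemma one_plus_neq_0 (u : C) : inD u -> (RtoC 1 + u)%C <> RtoC 0.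
Proof.
intros Hu H; assert (S := slit_one_plus u Hu); rewrite H, Cmod_0 in S.
unfold RtoC, Re in S; simpl in S; lra.
Qed.

Lemma logder_Cexp : logder Cexp (fun _ => RtoC 1).
Proof.
split; [|split; [|exact Cexp_0]].
- intros u _; split; [apply Cexp_neq_0|rewrite Cmult_1_l; apply cder_Cexp].
- apply cder_analytic with (df := fun _ => RtoC 0); intros z _; apply cder_const.
Qed.

Lemma logder_lemniscate :
  logder lemniscate (fun u => / ((RtoC 1 + RtoC 1) * (RtoC 1 + u)))%C.
Proof.
split; [|split].
- intros u Hu; assert (S := slit_one_plus u Hu); assert (N := Csqrt_neq_0 _ S).
  split; [exact N|].
  eapply cder_eq; [|apply (cder_comp Csqrt (fun u => RtoC 1 + u)%C);
    [apply cder_Csqrt, S|apply cder_plus; [apply cder_const|apply cder_id]]].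
  unfold lemniscate; set (v := Csqrt (RtoC 1 + u)) in *.
  replace (RtoC 1 + u)%C with (v * v)%C by apply Csqrt_mult.
  field; repeat split; first [exact N|exact two_neq_0].
- intros u Hu; eexists; apply is_derive_cder.
  apply (cder_inv (fun u => (RtoC 1 + RtoC 1) * (RtoC 1 + u))%C).
  + apply Cmult_neq_0; [exact two_neq_0|apply one_plus_neq_0, Hu].
  + apply cder_mult; [apply cder_const|apply cder_plus; [apply cder_const|apply cder_id]].
- unfold lemniscate; rewrite Cplus_0_r, Csqrt_real by lra; rewrite sqrt_1; reflexivity.
Qed.

Definition lune_root (u : C) : C := Csqrt (RtoC 1 + u * u)%C.

Lemma lune_root_neq_0 (u : C) : inD u -> lune_root u <> RtoC 0.
Proof. intros Hu; apply Csqrt_neq_0, slit_one_plus, inD_sqr, Hu. Qed.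

Lemma lune_root_sqr (u : C) : (lune_root u * lune_root u)%C = (RtoC 1 + u * u)%C.
Proof. apply Csqrt_mult. Qed.

Lemma cder_lune_root (u : C) : inD u -> cder lune_root u (u / lune_root u)%C.
Proof.
intros Hu; eapply cder_eq; [|apply (cder_comp Csqrt (fun u => RtoC 1 + u * u)%C);
  [apply cder_Csqrt, slit_one_plus, inD_sqr, Hu|
   apply cder_plus; [apply cder_const|apply cder_mult; apply cder_id]]].
cbv beta; fold (lune_root u); field; repeat split;
 first [apply lune_root_neq_0, Hu|exact two_neq_0].
Qed.

Lemma logder_lune : logder lune (fun u => / lune_root u)%C.
Proof.
split; [|split].
- intros u Hu; assert (N := lune_root_neq_0 u Hu); split.
  + intros H; assert (E := lune_root_sqr u).
    change (u + lune_root u = RtoC 0)%C in H.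
    replace (lune_root u) with ((u + lune_root u) - u)%C in E by ring.
    rewrite H in E; apply (RtoC_neq_0 1); [lra|].
    replace (RtoC 1) with ((RtoC 1 + u * u) - u * u)%C by ring; rewrite <- E; ring.
  + eapply cder_eq; [|apply cder_plus; [apply cder_id|apply (cder_lune_root u Hu)]].
    unfold lune; fold (lune_root u); field; exact N.
- intros u Hu; eexists; apply is_derive_cder, cder_inv;
   [apply lune_root_neq_0, Hu|apply cder_lune_root, Hu].
- unfold lune; rewrite Cmult_0_l, Cplus_0_r, Csqrt_real, sqrt_1 by lra; ring.
Qed.

(** For t = 1 + (3/2) q the hypotheses become Re t > 0 and |t - 1| <= 11/10. Hence |t|^2 <= 21/100 +
    2 Re t, which is enough unless |t| is small; then |t|^2 is itself below 2 |t|. *)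
Lemma in_cardioid_near_1 (q : C) : - (2 / 3) < Re q -> Cmod q <= 11 / 15 ->
  in_cardioid (RtoC 1 + q).
Proof.
intros Hre Hq; unfold in_cardioid.
set (t := card_sqr (RtoC 1 + q)).
assert (Et : t = (RtoC 1 + RtoC (3 / 2) * q)%C).
{ unfold t, card_sqr; destruct q as [x y].
  unfold RtoC, Cminus, Cplus, Copp, Cmult; simpl; f_equal; field. }
assert (E := Cmod_minus_1_sqr t).
assert (R1 : Re t = 1 + 3 / 2 * Re q).
{ rewrite Et; destruct q as [x y]; unfold RtoC, Cplus, Cmult, Re; simpl; ring. }
replace (t - RtoC 1)%C with (RtoC (3 / 2) * q)%C in E by (rewrite Et; ring).
rewrite Cmod_mult, Cmod_RtoC_pos in E by lra.
assert (Ht := Cmod_ge_0 t); assert (Hq0 := Cmod_ge_0 q).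
assert (3 / 2 * Cmod q * (3 / 2 * Cmod q) <= 121 / 100) by nra.
destruct (Rle_lt_dec (Cmod t) (1 / 5)); nra.
Qed.

Lemma in_cardioid_disk (q : C) : Cmod q < 2 / 3 -> in_cardioid (RtoC 1 + q).
Proof.
intros H; apply in_cardioid_near_1; [|lra].
generalize (Re_ge_opp_Cmod q); lra.
Qed.

(** Dieudonne's inequality reduces this to |z| + |w z| <= 1 - |z|^2. As |w z| <= |z|, that holds up
    to |z| = sqrt 2 - 1; 2/5 is a rational number between the three radii and this limit. *)
Lemma Cmod_zder_le (w : C -> C) (z : C) : schwarz w -> Cmod z <= 2 / 5 ->
  Cmod (z * C_derive w z) <= Cmod z.
Proof.
intros Hw Hz; destruct (Dieudonne w Hw z ltac:(unfold inD; lra)) as [H1 H2].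
assert (H3 := Cmod_le_sub (z * C_derive w z) (w z)).
assert (Hz0 := Cmod_ge_0 z); assert (Hw0 := Cmod_ge_0 (w z)).
set (rho := Cmod z) in *; set (t := Cmod (w z)) in *.
set (D := Cmod (z * C_derive w z - w z)) in *.
clearbody rho t D.
assert (D <= rho - t); [|lra].
apply Rmult_le_reg_r with (1 - rho * rho); [nra|].
apply Rle_trans with (1 := H2).
assert (0 <= (rho - t) * (1 - rho * rho - rho - t)) by (apply Rmult_le_pos; nra).
nra.
Qed.

Lemma Cmod_lemniscate_term (w : C -> C) (z : C) : schwarz w -> inD z ->
  Cmod (zlogder_comp (fun u => / ((RtoC 1 + RtoC 1) * (RtoC 1 + u)))%C w z)
  <= Cmod z / (2 * (1 - Cmod z)).
Proof.
intros Hw Hz; destruct (Dieudonne w Hw z Hz) as [H1 H2]; unfold inD in Hz.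
assert (HwD := proj1 (proj2 Hw) z Hz).
assert (H3 := Cmod_le_sub (z * C_derive w z) (w z)).
assert (Hz0 := Cmod_ge_0 z); assert (Hw0 := Cmod_ge_0 (w z)).
assert (H4 : 1 - Cmod (w z) <= Cmod (RtoC 1 + w z)).
{ generalize (Cmod_le_sub (RtoC 1) (RtoC 1 + w z)); rewrite Cmod_1.
  replace (RtoC 1 - (RtoC 1 + w z))%C with (- w z)%C by ring; rewrite Cmod_opp; lra. }
unfold zlogder_comp; rewrite Cmod_mult.
rewrite Cmod_inv by (apply Cmult_neq_0; [exact two_neq_0|apply one_plus_neq_0, HwD]).
rewrite (Cmod_mult (RtoC 1 + RtoC 1)), <- RtoC_plus, Cmod_RtoC_pos by lra.
set (rho := Cmod z) in *; set (t := Cmod (w z)) in *.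
set (D := Cmod (z * C_derive w z - w z)) in *.
set (X := Cmod (z * C_derive w z)) in *; set (Y := Cmod (RtoC 1 + w z)) in *.
assert (HX : X * (1 - rho) <= rho * (1 - t)).
{ apply Rmult_le_reg_r with (1 + rho); [lra|].
  assert (X * (1 - rho * rho) <= (t + D) * (1 - rho * rho)).
  { apply Rmult_le_compat_r; [nra|lra]. }
  (* This product is exactly rho (1 - t) (1 + rho) minus the bound t (1 - rho^2) + rho^2 - t^2 for X
     (1 - rho^2). *)
  assert (0 <= (rho - t) * (1 - t)) by (apply Rmult_le_pos; lra).
  nra. }
assert (HY : rho * (1 - t) <= rho * Y) by (apply Rmult_le_compat_l; lra).
apply Rmult_le_reg_r with (2 * (1 - rho) * Y); [apply Rmult_lt_0_compat; lra|].
replace (X * / ((1 + 1) * Y) * (2 * (1 - rho) * Y)) with (X * (1 - rho)) by (field; lra).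
replace (rho / (2 * (1 - rho)) * (2 * (1 - rho) * Y)) with (rho * Y) by (field; lra).
lra.
Qed.

(* Used with [x = - Re q], [n = |q|^2], [m^2 = |1 - q^2|] and [t = |w|], where
   [q = w / sqrt (1 + w^2)], so that [m = 1 / |sqrt (1 + w^2)|]. *)
Lemma lune_inequality (x n m t : R) : 0 < m -> 0 <= t -> x * x <= n ->
  n = t * t * (m * m) -> 77 * (t * t) <= 4 ->
  m * m * (m * m) = (1 + n) * (1 + n) - 4 * (x * x) ->
  m * m <= 77 / 73 /\ x + m * (4 - 77 * (t * t)) / 73 <= 2 / 9.
Proof.
intros Hm Ht Hxn En Htt Em.
set (M := m * m) in *.
assert (HM : 0 < M) by (unfold M; nra).
assert (Hx2 : 0 <= x * x) by nra.
assert (H1 : 77 * n <= 4 * M) by nra.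
assert (H2 : M <= 1 + n) by nra.
assert (H3 : n <= 4 / 73) by lra.
assert (H4 : 1 - n <= M) by nra.
assert (H5 : 9 / 10 <= m) by (unfold M in *; nra).
split; [lra|].
(* Equality holds for real q, where n = x^2 and M = 1 - x^2. In general, with y = x^2 and d = n - y,
   M^2 = (1 - y)^2 + 2 d (1 + y) + d^2 is at most (1 - y + 77 d / 4)^2, since y is small. *)
assert (H6 : 4 * M - 77 * n <= 4 - 81 * (x * x)).
{ assert (Hd : 0 <= n - x * x) by lra; set (d := n - x * x) in *.
  replace n with (x * x + d) in * by (unfold d; ring).
  set (y := x * x) in *.
  destruct (Rle_lt_dec (4 * M - 77 * (y + d)) (4 - 81 * y)) as [L|L]; [exact L|exfalso].
  assert (L1 : 1 - y + 77 / 4 * d < M) by lra.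
  assert (L0 : 0 <= 1 - y + 77 / 4 * d) by lra.
  assert (L2 : (1 - y + 77 / 4 * d) * (1 - y + 77 / 4 * d) < M * M) by nra.
  nra. }
set (Y := m * (4 - 77 * (t * t))).
assert (HY0 : 0 <= Y) by (apply Rmult_le_pos; lra).
assert (HY : Y * m = 4 * M - 77 * n) by (unfold Y; rewrite En; unfold M; ring).
assert (Hx : - (2 / 9) <= x <= 2 / 9) by (split; nra).
(* Factor 4 - 81 x^2 = (2 - 9 x) (2 + 9 x), where 2 + 9 x <= 4. With m >= 9/10 this gives Y <=
   (40/9) (2 - 9 x), while Y <= (73/9) (2 - 9 x) suffices. *)
assert (Y * m <= 4 * (2 - 9 * x)) by nra.
nra.
Qed.

(** Split Q = q + e / v with v = sqrt (1 + w^2), q = w / v and e = z w' - w. Dieudonne's inequality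
    bounds e, and [lune_inequality] weighs this bound against Re q. The value 11/45 is a third of
    the 11/15 allowed by [in_cardioid_near_1]. *)
Lemma lune_term (w : C -> C) (z : C) : schwarz w -> 77 * (Cmod z * Cmod z) < 4 ->
  let Q := zlogder_comp (fun u => / lune_root u)%C w z in
  Cmod Q <= 11 / 45 /\ - (2 / 9) < Re Q.
Proof.
intros Hw Hz Q; assert (Hz0 := Cmod_ge_0 z).
assert (Hz1 : Cmod z <= 2 / 5) by nra.
assert (HzD : inD z) by (unfold inD; lra).
destruct (Dieudonne w Hw z HzD) as [H1 H2].
assert (HwD := proj1 (proj2 Hw) z HzD).
assert (HX := Cmod_zder_le w z Hw Hz1).
set (u := w z) in *; set (v := lune_root u).
assert (Hv : v <> RtoC 0) by apply lune_root_neq_0, HwD.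
assert (Hvv : (v * v)%C = (RtoC 1 + u * u)%C) by apply lune_root_sqr.
assert (Hv0 : 0 < Cmod v) by apply Cmod_gt_0, Hv.
set (q := (u / v)%C); set (m := / Cmod v).
assert (Hm : 0 < m) by apply Rinv_0_lt_compat, Hv0.
assert (Hq : Cmod q = Cmod u * m) by (unfold q; rewrite Cmod_div by exact Hv; reflexivity).
assert (Hq2 : (RtoC 1 - q * q)%C = (/ (v * v))%C).
{ replace (RtoC 1 - q * q)%C with ((v * v - u * u) / (v * v))%C
    by (unfold q; field; exact Hv).
  replace (v * v - u * u)%C with (RtoC 1) by (rewrite Hvv; ring).
  apply Cmult_1_l. }
assert (Hmm : Cmod (RtoC 1 - q * q) = m * m).
{ rewrite Hq2, Cmod_inv, Cmod_mult by (apply Cmult_neq_0; exact Hv).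
  unfold m; apply Rinv_mult. }
(* The identity |1 - q^2|^2 = (1 + |q|^2)^2 - 4 (Re q)^2. *)
assert (Em : m * m * (m * m) = (1 + Cmod q * Cmod q) * (1 + Cmod q * Cmod q)
  - 4 * ((- Re q) * (- Re q))).
{ rewrite <- Hmm, !Cmod_sqr; destruct q as [x y].
  unfold RtoC, Cminus, Cplus, Copp, Cmult, Re, Im; simpl; ring. }
set (t := Cmod u) in *; assert (Ht : 0 <= t) by apply Cmod_ge_0.
destruct (lune_inequality (- Re q) (Cmod q * Cmod q) m t) as [I1 I2]; try assumption.
- rewrite Cmod_sqr; nra.
- rewrite Hq; ring.
- nra.
- assert (EQ : Q = (z * C_derive w z / v)%C) by reflexivity.
  split.
  + rewrite EQ, Cmod_div by exact Hv.
    change (Cmod (z * C_derive w z) * m <= 11 / 45).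
    apply Rle_trans with (Cmod z * m); [apply Rmult_le_compat_r; lra|].
    (* This gives |Q| <= 2 / sqrt 73, which is below 11/45. *)
    assert (Cmod z * m * (Cmod z * m) <= 4 / 73).
    { replace (Cmod z * m * (Cmod z * m)) with (Cmod z * Cmod z * (m * m)) by ring.
      replace (4 / 73) with (4 / 77 * (77 / 73)) by field.
      apply Rmult_le_compat; nra. }
    assert (0 <= Cmod z * m) by (apply Rmult_le_pos; lra).
    nra.
  + set (e := (z * C_derive w z - u)%C) in *.
    replace Q with (q + e / v)%C by (rewrite EQ; unfold q, e; field; exact Hv).
    rewrite Re_plus.
    assert (L := Re_ge_opp_Cmod (e / v)); rewrite Cmod_div in L by exact Hv.
    change (- (Cmod e * m) <= Re (e / v)) in L.
    assert (He0 := Cmod_ge_0 e).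
    (* The bound (|z|^2 - t^2) / (1 - |z|^2) increases with |z| and has this value at |z|^2 =
       4/77. *)
    assert (He : Cmod e < (4 - 77 * (t * t)) / 73) by nra.
    assert (Cmod e * m < (4 - 77 * (t * t)) / 73 * m) by (apply Rmult_lt_compat_r; assumption).
    lra.
Qed.

Lemma zlogder_comp_1 (w : C -> C) (z : C) :
  zlogder_comp (fun _ => RtoC 1) w z = (z * C_derive w z)%C.
Proof. unfold zlogder_comp; ring. Qed.

Lemma ratio_zlogder_split (L K w1 w2 w3 : C -> C) (z : C) :
  ratio_zlogder L K w1 w2 w3 z =
  (RtoC 1 + (zlogder_comp L w1 z + zlogder_comp L w2 z + zlogder_comp K w3 z))%C.
Proof. unfold ratio_zlogder; ring. Qed.

Lemma Cmod_triangle3 (a b c : C) : Cmod (a + b + c) <= Cmod a + Cmod b + Cmod c.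
Proof.
generalize (Cmod_triangle (a + b) c) (Cmod_triangle a b); lra.
Qed.

Lemma radius_T1 : is_radius starlike_c T1 (1 / 4).
Proof.
apply (is_radius_ratio_class _ _ _ _ _ logder_Cexp logder_lemniscate); [lra| |].
- intros w1 w2 w3 H1 H2 H3 z Hz; rewrite ratio_zlogder_split.
  apply in_cardioid_disk; rewrite !zlogder_comp_1.
  eapply Rle_lt_trans; [apply Cmod_triangle3|].
  assert (B1 := Cmod_zder_le w1 z H1 ltac:(lra)).
  assert (B2 := Cmod_zder_le w2 z H2 ltac:(lra)).
  assert (B3 := Cmod_lemniscate_term w3 z H3 ltac:(unfold inD; lra)).
  (* The budget at radius 1/4 is 1/4 + 1/4 + 1/6 = 2/3. *)
  assert (Cmod z / (2 * (1 - Cmod z)) < 1 / 6); [|lra].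
  apply Rmult_lt_reg_r with (2 * (1 - Cmod z)); [lra|].
  unfold Rdiv; rewrite Rmult_assoc, Rinv_l; lra.
- replace (RtoC 1 + - RtoC (1 / 4))%C with (RtoC (3 / 4))
    by (rewrite <- RtoC_opp, <- RtoC_plus; f_equal; lra).
  rewrite <- !RtoC_plus, <- RtoC_mult, <- RtoC_inv, <- !RtoC_plus, <- RtoC_mult by lra.
  f_equal; field.
Qed.

Lemma radius_T2 : is_radius starlike_c T2 ((4 - sqrt 10) / 3).
Proof.
assert (Hs := sqrt_sqrt 10 ltac:(lra)); assert (Hs0 := sqrt_pos 10).
set (s := sqrt 10) in *.
assert (Hs1 : 3 < s < 10 / 3) by (split; nra).
set (rad := (4 - s) / 3).
assert (Hr : 2 / 9 < rad < 1 / 3) by (unfold rad; lra).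
assert (Er : 3 * (rad * rad) - 8 * rad + 2 = 0) by (unfold rad; nra).
apply (is_radius_ratio_class _ _ _ _ _ logder_lemniscate logder_Cexp); [lra| |].
- intros w1 w2 w3 H1 H2 H3 z Hz; rewrite ratio_zlogder_split.
  apply in_cardioid_disk; rewrite !zlogder_comp_1.
  eapply Rle_lt_trans; [apply Cmod_triangle3|].
  assert (B1 := Cmod_lemniscate_term w1 z H1 ltac:(unfold inD; lra)).
  assert (B2 := Cmod_lemniscate_term w2 z H2 ltac:(unfold inD; lra)).
  assert (B3 := Cmod_zder_le w3 z H3 ltac:(lra)).
  (* Cleared of denominators this is 3 |z|^2 - 8 |z| + 2 > 0, true below the smaller root [rad]. *)
  assert (Cmod z / (2 * (1 - Cmod z)) < (2 / 3 - Cmod z) / 2); [|lra].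
  assert (Hz0 := Cmod_ge_0 z).
  apply Rmult_lt_reg_r with (2 * (1 - Cmod z)); [lra|].
  unfold Rdiv; rewrite Rmult_assoc, Rinv_l; nra.
- replace (RtoC 1 + - RtoC rad)%C with (RtoC (1 - rad))
    by (rewrite RtoC_minus; ring).
  rewrite <- !RtoC_plus, <- RtoC_mult, <- RtoC_inv, <- !RtoC_plus, <- RtoC_mult by lra.
  f_equal; apply Rmult_eq_reg_r with (3 * (1 - rad)); [|lra].
  field_simplify; lra.
Qed.

Lemma radius_T3 : is_radius starlike_c T3 (2 / sqrt 77).
Proof.
assert (Hs := sqrt_sqrt 77 ltac:(lra)); assert (Hs0 := sqrt_lt_R0 77 ltac:(lra)).
set (s := sqrt 77) in *.
set (rad := 2 / s).
assert (Er : 77 * (rad * rad) = 4) by (unfold rad; rewrite <- Hs; field; lra).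
assert (Hr0 : 0 < rad) by (apply Rdiv_lt_0_compat; lra).
apply (is_radius_ratio_class _ _ _ _ _ logder_lune logder_lune); [split; nra| |].
- intros w1 w2 w3 H1 H2 H3 z Hz; rewrite ratio_zlogder_split.
  assert (Hz2 : 77 * (Cmod z * Cmod z) < 4) by (generalize (Cmod_ge_0 z); nra).
  destruct (lune_term w1 z H1 Hz2) as [A1 B1].
  destruct (lune_term w2 z H2 Hz2) as [A2 B2].
  destruct (lune_term w3 z H3 Hz2) as [A3 B3].
  apply in_cardioid_near_1.
  + rewrite !Re_plus; lra.
  + eapply Rle_trans; [apply Cmod_triangle3|lra].
- unfold lune_root.
  replace (RtoC 1 + - RtoC rad * - RtoC rad)%C with (RtoC (1 + rad * rad))
    by (rewrite RtoC_plus, RtoC_mult; ring).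
  rewrite Csqrt_real by nra.
  (* Since 1 = (77/4) rad^2, the radicand is (81/4) rad^2. *)
  replace (sqrt (1 + rad * rad)) with (9 / 2 * rad).
  + rewrite <- RtoC_inv, <- !RtoC_plus, <- RtoC_mult by nra; f_equal; field; lra.
  + symmetry; apply sqrt_lem_1; nra.
Qed.

Theorem corollary3p4 :
  is_radius starlike_c T1 (1 / 4) /\
  is_radius starlike_c T2 ((4 - sqrt 10) / 3) /\
  is_radius starlike_c T3 (2 / sqrt 77).
Proof.
exact (conj radius_T1 (conj radius_T2 radius_T3)).
Qed.
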